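(* Let $s>0$ be a real number, let $\gamma:\widehat{G}\to(0,\infty)$ be a measurable function, let $\alpha>s$, and set $\alpha^*=\frac{2\alpha}{\alpha-s}$. If $\dfrac{1}{1+\gamma(\cdot)^2}\in L^\alpha(\widehat{G})$, then $\mathfrak{H}^s_\gamma(G,H)\hookrightarrow S_{\alpha^*}(H)$ (continuous embedding). Moreover, $$\|T\|_{S_{\alpha^*}(H)}\le\|T\|_{\mathfrak{H}^s_\gamma(G,H)}\left\|\dfrac{1}{1+\gamma(\cdot)^2}\right\|_{L^\alpha(\widehat{G})}^{\frac{s}{2}}\qquad\text{for all }T\in\mathfrak{H}^s_\gamma(G,H).$$
   Context: Setting. $G$ is a locally compact abelian Hausdorff group with neutral element $e$ and Pontryagin dual $\widehat{G}$; $H$ is a separable complex Hilbert space. $U:G\to U(H)$, $x\mapsto U_x$, is a (strongly continuous) irreducible unitary projective representation of $G$ on $H$: $U_xU_y=m(x,y)U_{xy}$ for all $x,y\in G$, with multiplier $m:G\times G\to\mathbb{T}$ (the unit circle), and $U_e=I$. Put $\sigma(x,y)=m(x,y)/m(y,x)$, so that $U_xU_y=\sigma(x,y)U_yU_x$. It is assumed that: $m$ is a Heisenberg multiplier, i.e. $x\mapsto\sigma(x,\cdot)$ is a topological isomorphism from $G$ onto $\widehat{G}$; $m(x,y)=m(x^{-1},y^{-1})$ for all $x,y\in G$; $U$ is square integrable, i.e. there are non-zero $\phi,\psi\in H$ with $x\mapsto\langle U_x\phi,\psi\rangle$ in $L^2(G)$; and $U$ is integrable, i.e. there is a non-zero $\psi\in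 H$ with $x\mapsto\langle U_x\psi,\psi\rangle$ in $L^1(G)$. One identifies $\widehat{G}$ with $G$ through $\sigma$: for $\xi=\sigma(x,\cdot)\in\widehat{G}$ one writes $U_\xi:=U_x$. Schatten classes. For $1\le p<\infty$, $S_p(H)$ is the space of compact operators on $H$ whose singular values are $p$-summable, with norm $\|T\|_{S_p(H)}$ equal to the $\ell^p$ norm of the singular values. $S_1(H)$ is the trace class and $S_2(H)$ the Hilbert-Schmidt class. Lebesgue spaces. For $0<\alpha<\infty$, $\|f\|_{L^\alpha(\widehat{G})}=\left(\int_{\widehat{G}}|f(\xi)|^\alpha d\xi\right)^{1/\alpha}$ (only a quasi-norm if $\alpha<1$), and $f\in L^\alpha(\widehat{G})$ means $f$ is measurable and this quantity is finite. Quantum Fourier transform. For $T\in S_1(H)$, $\mathcal{F}_U(T)(\xi)=\mathrm{tr}(TU_\xi^* )$, $\xi\in\widehat{G}$. The Haar measure $d\xi$ on $\widehat{G}$ is normalized so that the (known) Plancherel theorem holds: $\mathcal{F}_U$ extends (uniquely) from $S_1(H)$ to a unitary operator $\mathcal{F}_U:S_2(H)\to L^2(\widehat{G})$. This extension defines $\mathcal{F}_U$ on $S_2(H)$. Quantum Sobolev space. For $s>0$, $$\mathfrak{H}^s_\gamma(G,H)=\left\{T\in S_2(H) : \int_{\widehat{G}}(1+\gamma(\xi)^2)^s|\mathcal{F}_U(T)(\xi)|^2\,d\xi<\infty\right\},\quad \|T\|_{\mathfrak{H}^s_\gamma(G,H)}=\left(\int_{\widehat{G}}(1+\gamma(\xi)^2)^s|\mathcal{F}_U(T)(\xi)|^2\,d\xi\right)^{1/2}.$$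 Embeddings. For Banach spaces $X,Y$, $X\hookrightarrow Y$ means $X\subset Y$ and there is a constant $C>0$ with $\|x\|_Y\le C\|x\|_X$ for all $x\in X$. *)

(* Defs.v *)
From HB Require Import structures.
From mathcomp Require Import all_boot all_order all_algebra complex.
From mathcomp Require Import all_classical all_reals all_analysis.
From mathcomp Require Import ring.

Set Implicit Arguments.
Unset Strict Implicit.
Unset Printing Implicit Defensive.

Import Order.TTheory GRing.Theory Num.Theory numFieldNormedType.Exports.

Local Open Scope classical_set_scope.
Local Open Scope ring_scope.

(* The topology of R[i] is that of a numFieldType, and is only inferred when
   the carrier is presented through that structure. *)
Definition Cplx (R : realType) : numClosedFieldType := R[i].

(* Norms over Cplx R are Cplx R-valued; this is the real number they denote. *)
Definition rnorm (R : realType) (V : normedModType (Cplx R)) (v : V) : R :=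
  complex.Re (`|v| : R[i]).

HB.mixin Record CompleteNormedModule_isHilbert (R : realType) H
    & CompleteNormedModule (Cplx R) H := {
  dot : H -> H -> Cplx R ;
  dotPl : forall (a : Cplx R) (u v w : H),
    dot (a *: u + v) w = a * dot u w + dot v w ;
  dotC : forall u v : H, dot u v = (dot v u)^* ;
  dotE : forall u : H, dot u u = `|u| ^+ 2
}.

#[short(type="hilbertType")]
HB.structure Definition Hilbert (R : realType) :=
  {H of CompleteNormedModule (Cplx R) H & CompleteNormedModule_isHilbert R H}.

Section dual_group.
Context {R : realType} {G : topologicalZmodType}.

Definition characters : set {compact-open, G -> Cplx R} :=
  [set chi | [/\ continuous (chi : G -> Cplx R), forall x, `|chi x| = 1
               & forall x y, chi (x + y) = chi x * chi y]].

End dual_group.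

Definition dual_group (R : realType) (G : topologicalZmodType) : Type :=
  set_type (@characters R G).

HB.instance Definition _ (R : realType) (G : topologicalZmodType) :=
  Topological.copy (dual_group R G) (set_type (@characters R G)).

Definition chareval (R : realType) (G : topologicalZmodType)
  (chi : dual_group R G) : G -> Cplx R := set_val chi.
Coercion chareval : dual_group >-> Funclass.

Section dual_group_theory.
Context {R : realType} {G : topologicalZmodType}.
Implicit Types chi psi : dual_group R G.

Lemma charP chi : characters chi.
Proof. by apply: set_mem; exact: (valP chi). Qed.

Lemma char_continuous chi : continuous chi.
Proof. by case: (charP chi). Qed.

Lemma char_norm chi x : `|chi x| = 1.
Proof. by case: (charP chi). Qed.

Lemma charD chi x y : chi (x + y) = chi x * chi y.
Proof. by case: (charP chi). Qed.

Lemma char_neq0 chi x : chi x != 0.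
Proof. by rewrite -normr_eq0 char_norm oner_eq0. Qed.

Definition mkchar (f : G -> Cplx R) (fP : characters f) : dual_group R G :=
  exist _ f (mem_set fP).

Lemma char_ext chi psi : chi =1 psi -> chi = psi.
Proof. by move=> /funext e; exact: val_inj. Qed.

Lemma char0_subproof : characters (fun _ : G => 1 : Cplx R).
Proof.
by split=> [x|x|x y]; [exact: cvg_cst|rewrite normr1|rewrite mulr1].
Qed.

Lemma charN_subproof chi : characters (fun x : G => (chi x)^-1).
Proof.
split=> [x|x|x y]; last by rewrite charD invfM.
  by apply: cvgV; [exact: char_neq0|exact: char_continuous].
by rewrite normfV char_norm invr1.
Qed.

Lemma charD_subproof chi psi : characters (fun x : G => chi x * psi x).
Proof.
split=> [x|x|x y]; last by rewrite !charD mulrACA.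
  by apply: cvgM; exact: char_continuous.
by rewrite normrM !char_norm mulr1.
Qed.

Definition char0 : dual_group R G := mkchar char0_subproof.
Definition charN chi : dual_group R G := mkchar (charN_subproof chi).
Definition char_add chi psi : dual_group R G := mkchar (charD_subproof chi psi).

Lemma char_addA : associative char_add.
Proof. by move=> a b c; apply: char_ext => x; exact: mulrA. Qed.

Lemma char_addC : commutative char_add.
Proof. by move=> a b; apply: char_ext => x; exact: mulrC. Qed.

Lemma char_add0 : left_id char0 char_add.
Proof. by move=> a; apply: char_ext => x; exact: mul1r. Qed.

Lemma char_addN : left_inverse char0 charN char_add.
Proof.
move=> a; apply: char_ext => x.
exact/mulVf/char_neq0.
Qed.

End dual_group_theory.

HB.instance Definition _ (R : realType) (G : topologicalZmodType) :=
  GRing.isZmodule.Build (dual_group R G)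
    char_addA char_addC char_add0 char_addN.

Section dual_group_topology.
Context {R : realType} {G : topologicalZmodType}.
Local Notation D := (dual_group R G).

Lemma dual_nbhs_uniform (x : D) (K : set G) (e : Cplx R) :
  compact K -> 0 < e ->
  @nbhs D D x [set y | forall t, K t -> `|x t - y t| < e].
Proof.
move=> cK e0.
have : {family compact, fmap (@chareval R G) (@nbhs D D x) --> chareval x}.
  apply/compact_open_fam_compactP.
  - exact: char_continuous.
  - exact/fmap_filter/(nbhs_filter (x : D)).
  - exact: (@initial_continuous _ {compact-open, G -> Cplx R} set_val x).
have FF : Filter (fmap (@chareval R G) (@nbhs D D x)).
  exact/fmap_filter/(nbhs_filter (x : D)).
move=> /fam_cvgP/(_ K cK); apply; apply/uniform_nbhs.
exists [set p | ball p.1 e p.2]; split; last by [].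
by rewrite -entourage_ballE; exists e.
Qed.

Lemma dual_sub_continuous : continuous (fun p : D * D => p.1 - p.2).
Proof.
apply: (@continuous_comp_initial _ _ {compact-open, G -> Cplx R}) => -[x y].
have FF : Filter (fmap (fun p : D * D => chareval (p.1 - p.2))
    (nbhs ((x, y) : D * D))).
  by apply: fmap_filter; exact: (@nbhs_filter (D * D)%type (x, y)).
suff : {family compact, fmap (fun p : D * D => chareval (p.1 - p.2))
    (nbhs ((x, y) : D * D)) --> chareval (x - y)}.
  by move=> /(compact_open_fam_compactP (@char_continuous R G (x - y)) FF).
apply/fam_cvgP => K cK P /uniform_nbhs[E [+ EP]].
rewrite -entourage_ballE => -[e /= e0 eE].
have e20 : 0 < e / 2 by rewrite divr_gt0.
exists ([set z : D | forall t, K t -> `|chareval x t - z t| < e / 2],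
        [set z : D | forall t, K t -> `|chareval y t - z t| < e / 2]).
  by split => /=; exact: dual_nbhs_uniform.
move=> [a b] /= [xa yb]; apply: EP => t Kt; apply: eE => /=.
rewrite /ball/=.
have -> : chareval (x - y) t - chareval (a - b) t =
    ((chareval x t - chareval a t) * chareval b t
     - chareval a t * (chareval y t - chareval b t))
    * ((chareval y t)^-1 * (chareval b t)^-1).
  have yN0 := char_neq0 y t; have bN0 := char_neq0 b t.
  rewrite -[chareval (x - y) t]/(chareval x t * (chareval y t)^-1).
  rewrite -[chareval (a - b) t]/(chareval a t * (chareval b t)^-1).
  by field; rewrite yN0 bN0.
rewrite !normrM !normfV !char_norm invr1 !mulr1.
rewrite (le_lt_trans (ler_normB _ _)) // !normrM !char_norm mulr1 mul1r.
by rewrite [e]splitr ltrD ?xa ?yb.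
Qed.

End dual_group_topology.

HB.instance Definition _ (R : realType) (G : topologicalZmodType) :=
  PreTopologicalNmodule_isTopologicalZmodule.Build (dual_group R G)
    (@dual_sub_continuous R G).

Definition topological_isomorphism (G K : topologicalZmodType) (f : G -> K) :=
  [/\ {morph f : x y / x + y}, continuous f
    & exists g : K -> G, [/\ cancel f g, cancel g f & continuous g]].

(* Measurable types are pointed, which topological groups are not by default:
   hence this alias, pointed at the neutral element. *)
Definition borel (G : topologicalZmodType) : Type := G.

HB.instance Definition _ (G : topologicalZmodType) := Choice.on (borel G).
HB.instance Definition _ (G : topologicalZmodType) :=
  isPointed.Build (borel G) (0 : G).
HB.instance Definition _ (G : topologicalZmodType) :=
  Measurable.copy (borel G)
    (g_sigma_algebraType (@open G : set (set (borel G)))).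

Section haar.
Context {R : realType} {G : topologicalZmodType}.
Variable mu : {measure set (borel G) -> \bar R}.
Local Open Scope ereal_scope.

Definition outer_regular (A : set G) :=
  mu A = ereal_inf [set mu O | O in [set O : set G | open O /\ A `<=` O]].

Definition inner_regular (A : set G) :=
  mu A = ereal_sup [set mu K | K in [set K : set G | compact K /\ K `<=` A]].

Definition haar_measure :=
  [/\ mu setT != 0,
      forall K : set G, compact K -> mu K < +oo,
      forall A : set (borel G), measurable A -> outer_regular A,
      forall O : set G, open O -> inner_regular O
    & forall (x : G) (A : set (borel G)), measurable A ->
        mu [set (x + y)%R | y in (A : set G)] = mu A].

End haar.

Section Lebesgue_spaces.
Context {d : measure_display} {T : measurableType d} {R : realType}.
Variables (mu : {measure set T -> \bar R}) (a : R).

Definition in_Lp (f : T -> R) :=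
  measurable_fun setT f /\ finite_norm mu a%:E f.

Definition in_cLp (f : T -> Cplx R) :=
  [/\ measurable_fun setT (fun x => complex.Re (f x : R[i])),
      measurable_fun setT (fun x => complex.Im (f x : R[i]))
    & finite_norm mu a%:E (fun x => rnorm (f x))].

End Lebesgue_spaces.

Section operators.
Context {R : realType} {H : hilbertType R}.
Local Notation C := (Cplx R).
Implicit Types (T : H -> H) (V : set H) (e : nat -> H).

Definition separable_space := exists2 D : set H, countable D & dense D.

Definition bounded_operator T := linear T /\ continuous T.

(* Junk value where no representing vector exists; by the Riesz theorem this
   does not happen for bounded T. *)
Definition adjoint T (y : H) : H :=
  xget 0 [set z | forall x, dot (T x) y = dot x z].

Definition unitary T :=
  [/\ bounded_operator T, adjoint T \o T =1 id & T \o adjoint T =1 id].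

Definition closed_subspace V :=
  [/\ closed V, V 0 & forall (a : C) u v, V u -> V v -> V (a *: u + v)].

Definition linearly_independent n (v : 'I_n -> H) :=
  forall c : 'I_n -> C, \sum_(i < n) c i *: v i = 0 -> forall i, c i = 0.

Definition vdim V : \bar R :=
  ereal_sup [set n%:R%:E | n in [set n | exists v : 'I_n -> H,
    (forall i, V (v i)) /\ linearly_independent v]].

(* Zero vectors are allowed, so that finite-dimensional spaces are covered:
   the non-zero e n form an orthonormal basis. *)
Definition hilbert_basis e :=
  [/\ forall i j, i != j -> dot (e i) (e j) = 0,
      forall i, e i = 0 \/ `|e i| = 1
    & forall v, (forall i, dot v (e i) = 0) -> v = 0].

Definition trace T : C :=
  xget 0 [set c | forall e, hilbert_basis e ->
    series (fun n => dot (T (e n)) (e n)) @ \oo --> c].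

Definition compact_operator T :=
  linear T /\ precompact [set T v | v in [set v : H | `|v| <= 1]].

(* The number of singular values of T equal to r > 0, i.e. the multiplicity of
   r as an eigenvalue of (T^* T)^(1/2), that is of r^2 as one of T^* T. *)
Definition singular_multiplicity T (r : R) : \bar R :=
  vdim [set v | adjoint T (T v) = ((r ^+ 2)%:C)%C *: v].

(* The l^p norm of the singular values, grouped by value. *)
Definition schatten_norm (p : R) T : \bar R :=
  ((\esum_(r in [set r : R | (0 < r)%R])
     (singular_multiplicity T r * (r `^ p)%R%:E)) `^ p^-1)%E.

Definition schatten (p : R) : set (H -> H) :=
  [set T | compact_operator T /\ (schatten_norm p T < +oo)%E].

End operators.

Section projective_representations.
Context {R : realType} {G : topologicalZmodType} {H : hilbertType R}.
Variables (m : G -> G -> Cplx R) (U : G -> H -> H).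

Definition projective_representation :=
  [/\ forall x, unitary (U x),
      forall v, continuous (fun x => U x v),
      forall x y, `|m x y| = 1,
      forall v, U 0 v = v
    & forall x y v, U x (U y v) = m x y *: U (x + y) v].

Definition irreducible :=
  forall V : set H, closed_subspace V ->
    (forall x v, V v -> V (U x v)) -> V = [set 0] \/ V = setT.

Definition symplectic (x y : G) : Cplx R := m x y / m y x.

Definition heisenberg_multiplier :=
  exists2 f : G -> dual_group R G,
    (forall x y, f x y = symplectic x y) & topological_isomorphism f.

Definition square_integrable (nu : {measure set (borel G) -> \bar R}) :=
  exists phi psi : H, [/\ phi != 0, psi != 0
    & in_cLp nu 2 (fun x : borel G => dot (U x phi) psi)].

Definition integrable_representation
    (nu : {measure set (borel G) -> \bar R}) :=
  exists2 psi : H, psi != 0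
    & in_cLp nu 1 (fun x : borel G => dot (U x psi) psi).

Definition Udual (xi : dual_group R G) : H -> H :=
  U (xget 0 [set x | forall y, symplectic x y = xi y]).

Definition trace_fourier (T : H -> H) (xi : dual_group R G) : Cplx R :=
  trace (T \o adjoint (Udual xi)).

(* F is the extension of trace_fourier to a unitary operator from the
   Hilbert-Schmidt class onto L^2 of the dual group, each class of functions
   modulo mu being given through a representative. The existence of such an F
   is what normalizes the Haar measure mu, and it is unique modulo mu. *)
Definition quantum_fourier (mu : {measure set (borel (dual_group R G)) -> \bar R})
    (F : (H -> H) -> borel (dual_group R G) -> Cplx R) :=
  [/\ forall T, schatten 1 T -> {ae mu, forall xi, F T xi = trace_fourier T xi},
      forall T, schatten 2 T -> in_cLp mu 2 (F T),
      forall (a : Cplx R) S T, schatten 2 S -> schatten 2 T ->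
        {ae mu, forall xi,
          F (fun v => a *: S v + T v) xi = a * F S xi + F T xi},
      forall T, schatten 2 T ->
        Lnorm mu 2%:E (fun xi => (rnorm (F T xi))%:E) = schatten_norm 2 T
    & forall g, in_cLp mu 2 g ->
        exists2 T, schatten 2 T & {ae mu, forall xi, F T xi = g xi}].

End projective_representations.

Section sobolev.
Context {R : realType} {G : topologicalZmodType} {H : hilbertType R}.
Variables (mu : {measure set (borel (dual_group R G)) -> \bar R})
  (F : (H -> H) -> borel (dual_group R G) -> Cplx R)
  (gamma : borel (dual_group R G) -> R) (s : R).
Local Open Scope ereal_scope.

Definition sobolev_integral (T : H -> H) : \bar R :=
  \int[mu]_xi ((1 + gamma xi ^+ 2) `^ s * rnorm (F T xi) ^+ 2)%R%:E.

Definition sobolev_norm (T : H -> H) : \bar R := sobolev_integral T `^ 2^-1.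

Definition sobolev : set (H -> H) :=
  [set T | schatten 2 T /\ sobolev_integral T < +oo].

End sobolev.

Definition continuously_embedded (R : realType) (E : Type)
    (X : set E) (normX : E -> \bar R) (Y : set E) (normY : E -> \bar R) :=
  X `<=` Y /\ exists2 c : R, 0 < c
    & forall x, X x -> (normY x <= c%:E * normX x)%E.

(* Main.v *)
(* Put q = alpha_star and let p be its conjugate exponent. Hoelder's inequality
   bounds the L^p norm of f = F T by the Sobolev norm of T times the power of the
   norm of w, so it remains to bound the l^q norm of the singular values r_i of T
   by the L^p norm of f.

   If e_i are orthonormal eigenvectors of T^* T for the eigenvalues r_i^2 and
   f_i = T e_i / r_i, the transforms phi_i of the rank one operators
   S_i v = <v, e_i> f_i are bounded by their trace norm 1, and adding a
   nonnegative combination of the S_i to T only shifts the singular values r_i.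
   Plancherel's theorem and polarization then give that the phi_i are
   orthonormal in L^2 (for the real part of the inner product, which suffices)
   and that the coefficients of f along them are the r_i.

   The bound is thus the Hausdorff-Young inequality of F. Riesz for orthonormal
   systems bounded by 1. In its dual form it says that the L^q norm of
   sum_i c_i phi_i is at most the l^p norm of c. A constant A, uniform in q, for
   the q-th power of this inequality can be replaced by its square root, and
   A = N works for a system of N functions, so A = 1 works in the limit. *)

Require Import Defs.
From HB Require Import structures.
From mathcomp Require Import all_boot all_order all_algebra complex.
From mathcomp Require Import all_classical all_reals all_analysis.
From mathcomp Require Import measurable_realfun.
From mathcomp Require Import ring lra.

Set Implicit Arguments.
Unset Strict Implicit.
Unset Printing Implicit Defensive.

Import Order.TTheory GRing.Theory Num.Theory numFieldNormedType.Exports.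

Local Open Scope classical_set_scope.
Local Open Scope ring_scope.

(** The estimate is claimed with constant 1, so no loss in a constant is allowed. This is why the
    argument works with finitely many functions: the crude constant [N] is available there and
    maximizers exist by compactness, while complex interpolation is not involved.

    No diagonalization of T^* T is needed. Both the sum over the singular values and their
    multiplicities are suprema over finite families, so it is enough to treat finite orthonormal
    systems of eigenvectors.

    Plancherel's theorem speaks of norms only, and the norm of a sum of operators is accessible only
    if its singular values are known. Put T' = T - sum r_i S_i. It kills every e_i and its range is
    orthogonal to every f_i, so T' + sum b_i S_i, for b_i >= 0, has the singular values of T'
    together with the b_i. This covers T + S_i and T + S_i + S_j, and expanding the squares of their
    norms gives all inner products.

    The coefficients r_i^(q-1) that extract the l^q norm are real. Hence complex functions can be
    carried as pairs of real ones, with real linear combinations. *)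

Ltac nz := repeat (apply/andP; split); apply: lt0r_neq0; lra.

(** * Hausdorff-Young inequality for bounded orthonormal systems *)

Section power_inequalities.
Context {R : realType}.
Implicit Types a b q t : R.

Lemma powR_mul_ge0 a s t : 0 <= s -> 0 <= t -> a `^ s * a `^ t = a `^ (s + t).
Proof.
move=> s0 t0; have [->|a0] := eqVneq a 0; last by rewrite powRD ?a0 ?implybT.
move: s0; rewrite le_eqVlt => /predU1P[<-|s0]; first by rewrite powRr0 mul1r add0r.
rewrite (@powR0 _ s); last nz.
by rewrite mul0r powR0//; nz.
Qed.

(** The graph of the [t]-th power lies above its tangent at [a]; rearranged, this is Young's
    inequality. The Lipschitz bound and Jensen's inequality below are read off from it. *)
Lemma powR_tangent a b t : 0 <= a -> 0 <= b -> 1 <= t ->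
  a `^ (t - 1) * b <= (1 - t^-1) * a `^ t + t^-1 * b `^ t.
Proof.
move=> a0 b0; rewrite le_eqVlt => /predU1P[<-|t1].
  by rewrite subrr powRr0 !powRr1// invr1; lra.
have t0 : 0 < t by lra.
have -> : a `^ t = (a `^ (t - 1)) `^ (t / (t - 1)).
  by rewrite -powRrM; congr powR; field; nz.
have e : (1 - t^-1) = (t / (t - 1))^-1 by field; nz.
rewrite e ![_^-1 * _]mulrC.
apply: conjugate_powR => //; first exact: powR_ge0.
  by rewrite divr_gt0//; lra.
by rewrite -e; ring.
Qed.

Lemma powR_lipschitz a b (K : R) t : 0 <= a <= K -> 0 <= b <= K -> 1 <= t ->
  `|a `^ t - b `^ t| <= t * K `^ (t - 1) * `|a - b|.
Proof.
wlog ba : a b / b <= a => [wl|] aK bK t1.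
  have [/wl|/ltW/wl] := leP b a; first exact.
  by rewrite distrC [`|a - b|]distrC; exact.
move: aK bK => /andP[a0 aK] /andP[b0 bK].
rewrite !ger0_norm ?subr_ge0 ?ge0_ler_powR ?nnegrE//; last lra.
have aK' : a `^ (t - 1) <= K `^ (t - 1).
  by apply: ge0_ler_powR; rewrite ?nnegrE//; lra.
apply: (@le_trans _ _ (t * a `^ (t - 1) * (a - b))); last first.
  by rewrite ler_wpM2r ?ler_wpM2l//; lra.
have := powR_tangent a0 b0 t1.
have t0 : 0 < t by lra.
rewrite -(ler_pM2l t0) => h.
have e1 : a `^ (t - 1) * a = a `^ t by rewrite mulrC mulr_powRB1.
have e2 : t * ((1 - t^-1) * a `^ t + t^-1 * b `^ t) = (t - 1) * a `^ t + b `^ t.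
  by field; nz.
rewrite e2 in h.
by rewrite mulrBr -[t * _ * a]mulrA e1; lra.
Qed.

Lemma powR_jensen (I : finType) (w x : I -> R) t : 1 <= t ->
  (forall i, 0 <= w i) -> \sum_i w i = 1 -> (forall i, 0 <= x i) ->
  (\sum_i w i * x i) `^ t <= \sum_i w i * x i `^ t.
Proof.
move=> t1 w0 w1 x0; have t0 : 0 < t by lra.
set m := \sum_i _.
have m0 : 0 <= m by apply: sumr_ge0 => i _; exact: mulr_ge0.
have : \sum_i w i * (m `^ (t - 1) * x i) <=
   \sum_i w i * ((1 - t^-1) * m `^ t + t^-1 * x i `^ t).
  by apply: ler_sum => i _; rewrite ler_wpM2l// powR_tangent.
under eq_bigr do rewrite mulrCA.
rewrite -mulr_sumr -/m mulrC mulr_powRB1//.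
under eq_bigr do rewrite mulrDr [w _ * (t^-1 * _)]mulrCA.
rewrite big_split/= -mulr_suml w1 mul1r -mulr_sumr => h.
have t1' : 0 < t^-1 by rewrite invr_gt0.
by rewrite -(ler_pM2l t1'); lra.
Qed.

(* The square term is what makes the equality case of Young's inequality rigid. *)
Lemma young_deficit a b q : 2 <= q -> 0 <= a -> 0 <= b ->
  a `^ (1 - q^-1) * b `^ q^-1 <=
  (1 - q^-1) * a + q^-1 * b - q^-1 * (Num.sqrt a - Num.sqrt b) ^+ 2.
Proof.
move=> q2 a0 b0; have q0 : 0 < q by lra.
have [->|q2'] := eqVneq q 2.
  rewrite (_ : 1 - 2^-1 = 2^-1); last by lra.
  rewrite !powR12_sqrt// -{2}(sqr_sqrtr a0) -{2}(sqr_sqrtr b0).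
  by rewrite -subr_ge0 [leRHS](_ : _ = 0)//; field.
have q2s : 2 < q by rewrite lt_neqAle eq_sym q2'.
have iq0 : 0 < q^-1 by rewrite invr_gt0.
have iq2 : q^-1 < 2^-1 by rewrite ltf_pV2// posrE.
(* The product is regrouped as a geometric mean of a and sqrt(ab) with weights 1 - 2/q and 2/q.
   After Young's inequality, 2 sqrt(ab) = a + b - (sqrt a - sqrt b)^2 produces the square. *)
have -> : a `^ (1 - q^-1) * b `^ q^-1 =
   a `^ (1 - 2 * q^-1) * (Num.sqrt a * Num.sqrt b) `^ (2 * q^-1).
  rewrite powRM ?sqrtr_ge0// -!powR12_sqrt// -!powRrM mulrA.
  have e : 2^-1 * (2 * q^-1) = q^-1 by field; nz.
  rewrite e powR_mul_ge0; first by congr (_ `^ _ * _); ring.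
    by lra.
  by lra.
have ab0 : 0 <= Num.sqrt a * Num.sqrt b by rewrite mulr_ge0// sqrtr_ge0.
have p0 : 0 < 1 - 2 * q^-1 by lra.
have p0' : 0 < 2 * q^-1 by lra.
have h := @conjugate_powR R (a `^ (1 - 2 * q^-1))
   ((Num.sqrt a * Num.sqrt b) `^ (2 * q^-1)) (1 - 2 * q^-1)^-1 (2 * q^-1)^-1.
rewrite !invr_gt0 !invrK !powR_ge0 -!powRrM in h.
rewrite !divff ?powRr1// in h; [|nz|nz].
apply: le_trans (h _ _ _ _ _) _ => //; first by ring.
rewrite -{3}(sqr_sqrtr a0) -{2}(sqr_sqrtr b0).
rewrite -{1}(sqr_sqrtr a0).
rewrite -subr_ge0 [leRHS](_ : _ = 0)//; ring.
Qed.

Lemma young_eq a b q : 2 <= q -> 0 <= a -> 0 <= b ->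
  (1 - q^-1) * a + q^-1 * b <= a `^ (1 - q^-1) * b `^ q^-1 -> a = b.
Proof.
move=> q2 a0 b0 h; have := young_deficit q2 a0 b0.
have iq0 : 0 < q^-1 by rewrite invr_gt0; lra.
move=> h'; have : (Num.sqrt a - Num.sqrt b) ^+ 2 <= 0.
  by rewrite -(pmulr_rle0 _ iq0); lra.
rewrite real_exprn_even_le0 ?num_real//= => /eqP ab.
by rewrite -(sqr_sqrtr a0) -(sqr_sqrtr b0) (_ : Num.sqrt a = Num.sqrt b)//; lra.
Qed.

End power_inequalities.

(** * Real square integrable functions and their inner product *)

Section square_integrable_functions.
Context {d : measure_display} {T : measurableType d} {R : realType}.
Variable mu : {measure set T -> \bar R}.
Implicit Types u v w : T -> R.

Definition integrableR u := mu.-integrable setT (EFin \o u).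

Lemma integrableRE u : integrableR u <->
  measurable_fun setT u /\ (\int[mu]_x `|(u x)%:E| < +oo)%E.
Proof.
split; first by case/integrableP => /measurable_EFinP.
by case=> mu1 i; apply/integrableP; split => //; exact/measurable_EFinP.
Qed.

Lemma integrableR_measurable u : integrableR u -> measurable_fun setT u.
Proof. by case/integrableRE. Qed.

Lemma le_integrableR u v : measurable_fun setT u ->
  (forall x, `|u x| <= v x) -> integrableR v -> integrableR u.
Proof.
move=> mu1 uv; apply: le_integrable => //; first exact/measurable_EFinP.
by move=> x _ /=; rewrite lee_fin (le_trans (uv x))// ler_norm.
Qed.

Lemma integrableRD u v : integrableR u -> integrableR v ->
  integrableR (fun x => u x + v x).
Proof.
move=> iu iv; have := integrableD measurableT iu iv.
by apply: eq_integrable => // x _.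
Qed.

Lemma integrableRZ k u : integrableR u -> integrableR (fun x => k * u x).
Proof.
move=> iu; have := integrableZl measurableT k iu.
by apply: eq_integrable => // x _.
Qed.

Definition sqint u := measurable_fun setT u /\ integrableR (fun x => u x ^+ 2).

Lemma sqintM u v : sqint u -> sqint v -> integrableR (fun x => u x * v x).
Proof.
move=> [mu1 iu] [mv iv].
apply: (@le_integrableR _ (fun x => u x ^+ 2 + v x ^+ 2)).
- exact: measurable_funM.
- move=> x; rewrite ler_norml; apply/andP; split.
    have h := sqr_ge0 (u x + v x); have := sqr_ge0 (u x); have := sqr_ge0 (v x).
    by rewrite sqrrD in h; rewrite !expr2 in h *; lra.
  have h := sqr_ge0 (u x - v x); have := sqr_ge0 (u x); have := sqr_ge0 (v x).
  by rewrite sqrrB in h; rewrite !expr2 in h *; lra.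
- exact: integrableRD.
Qed.

Lemma sqintD u v : sqint u -> sqint v -> sqint (fun x => u x + v x).
Proof.
move=> su sv; split; first by apply: measurable_funD; [case: su|case: sv].
have := integrableRD (integrableRD su.2 sv.2) (integrableRZ 2 (sqintM su sv)).
by congr integrableR; apply/funext => x; ring.
Qed.

Lemma sqintZ k u : sqint u -> sqint (fun x => k * u x).
Proof.
move=> [mu1 iu]; split; first exact: measurable_funM.
have := integrableRZ (k ^+ 2) iu.
by congr integrableR; apply/funext => x; ring.
Qed.

Lemma sqint0 : sqint (fun=> 0).
Proof.
split; first exact: measurable_cst.
have := integrable0 mu (setT : set T).
by apply: eq_integrable => // x _ /=; rewrite expr0n.
Qed.

Lemma sqint_sum (I : Type) (r : seq I) (u : I -> T -> R) (c : I -> R) :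
  (forall i, sqint (u i)) -> sqint (fun x => \sum_(i <- r) c i * u i x).
Proof.
move=> su; elim: r => [|i r ih].
  by under eq_fun do rewrite big_nil; exact: sqint0.
under eq_fun do rewrite big_cons; apply: sqintD => //; exact: sqintZ.
Qed.

Definition ip u v := \int[mu]_x (u x * v x).

Lemma ipC u v : ip u v = ip v u.
Proof. by apply: eq_Rintegral => x _; rewrite mulrC. Qed.

Lemma ipDl u v w : sqint u -> sqint v -> sqint w ->
  ip (fun x => u x + v x) w = ip u w + ip v w.
Proof.
move=> su sv sw; rewrite -RintegralD//; [|exact: sqintM|exact: sqintM].
by apply: eq_Rintegral => x _; rewrite mulrDl.
Qed.

Lemma ipZl k u w : sqint u -> sqint w ->
  ip (fun x => k * u x) w = k * ip u w.
Proof.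
move=> su sw; rewrite -RintegralZl//; last exact: sqintM.
by apply: eq_Rintegral => x _; rewrite mulrA.
Qed.

Lemma ip_suml (I : Type) (r : seq I) (u : I -> T -> R) (c : I -> R) w :
  (forall i, sqint (u i)) -> sqint w ->
  ip (fun x => \sum_(i <- r) c i * u i x) w = \sum_(i <- r) c i * ip (u i) w.
Proof.
move=> su sw; elim: r => [|i r ih].
  rewrite big_nil /ip (_ : (fun x => _) = cst 0).
    by rewrite Rintegral_cst// mul0r.
  by apply/funext => x; rewrite big_nil mul0r.
rewrite big_cons -ih -ipZl// -ipDl//; last 2 first.
- exact: sqintZ.
- exact: sqint_sum.
by congr ip; apply/funext => x; rewrite big_cons.
Qed.

Lemma ip_ge0 u : 0 <= ip u u.
Proof. by apply: Rintegral_ge0 => x _; rewrite -expr2 sqr_ge0. Qed.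

End square_integrable_functions.

Section modulus.
Context {R : realType}.
Implicit Types a b c e : R.

Definition modulus a b := Num.sqrt (a ^+ 2 + b ^+ 2).

Lemma modulus_ge0 a b : 0 <= modulus a b. Proof. exact: sqrtr_ge0. Qed.

Lemma sqr_modulus a b : modulus a b ^+ 2 = a ^+ 2 + b ^+ 2.
Proof. by rewrite sqr_sqrtr// addr_ge0// sqr_ge0. Qed.

Lemma modulusZ k a b : modulus (k * a) (k * b) = `|k| * modulus a b.
Proof. by rewrite /modulus !exprMn -mulrDr sqrtrM ?sqr_ge0// sqrtr_sqr. Qed.

Lemma modulus_dot a b c e : `|a * c + b * e| <= modulus a b * modulus c e.
Proof.
rewrite -ler_sqr ?nnegrE ?mulr_ge0 ?modulus_ge0//.
rewrite exprMn !sqr_modulus real_normK ?num_real//.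
have := sqr_ge0 (a * e - b * c).
move=> h; rewrite -subr_ge0; apply: le_trans h _.
by rewrite le_eqVlt; apply/orP; left; apply/eqP; ring.
Qed.

Lemma modulusD a b c e :
  modulus (a + c) (b + e) <= modulus a b + modulus c e.
Proof.
rewrite -ler_sqr ?nnegrE ?addr_ge0 ?modulus_ge0//.
rewrite sqrrD !sqr_modulus.
have := le_trans (ler_norm _) (modulus_dot a b c e).
by rewrite !expr2; lra.
Qed.

Lemma modulusB a b c e :
  `|modulus a b - modulus c e| <= modulus (a - c) (b - e).
Proof.
have h1 := modulusD (a - c) (b - e) c e.
have h2 := modulusD (c - a) (e - b) a b.
rewrite !subrK in h1 h2.
have e1 : modulus (c - a) (e - b) = modulus (a - c) (b - e).
  by rewrite /modulus -(opprB a c) -(opprB b e) !sqrrN.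
by rewrite ler_norml; lra.
Qed.

Lemma modulus_sum (I : Type) (r : seq I) (c u v : I -> R) :
  modulus (\sum_(i <- r) c i * u i) (\sum_(i <- r) c i * v i) <=
  \sum_(i <- r) `|c i| * modulus (u i) (v i).
Proof.
elim: r => [|i r ih]; first by rewrite !big_nil /modulus expr0n addr0 sqrtr0.
rewrite !big_cons; apply: le_trans (modulusD _ _ _ _) _.
by rewrite modulusZ lerD2l.
Qed.

Lemma measurable_modulus d (T : measurableType d) (u v : T -> R) :
  measurable_fun setT u -> measurable_fun setT v ->
  measurable_fun setT (fun x => modulus (u x) (v x)).
Proof.
move=> mu1 mv; rewrite (_ : (fun x => _) = (fun x => (u x ^+ 2 + v x ^+ 2) `^ (2^-1))).
  apply: (measurableT_comp (measurable_powR _)).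
  by apply: measurable_funD; exact: measurable_funX.
by apply/funext => x; rewrite powR12_sqrt// addr_ge0// sqr_ge0.
Qed.

End modulus.

(** * Finite sequences: extremal pairs in l^p duality, compact spheres *)

Section finite_sequences.
Context {R : realType} {N : nat}.
Implicit Types (c e : 'I_N -> R) (v w : 'rV[R]_N).

(** Equality case of Hoelder's inequality. Testing [bound] on the extremal sequence shows that the
    |e_i|^q sum to at most 1. The gaps in Young's inequality for the products [c i * e i] then have
    a sum at most 0, so each gap vanishes and [young_eq] applies. *)
Lemma powR_dual_extremal q c e : 2 <= q ->
  \sum_i `|c i| `^ (q / (q - 1)) = 1 -> \sum_i c i * e i = 1 ->
  (forall b : 'I_N -> R, \sum_i `|b i| `^ (q / (q - 1)) = 1 ->
     \sum_i b i * e i <= 1) ->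
  forall i, `|c i| `^ (q / (q - 1)) = `|e i| `^ q.
Proof.
move=> q2 c1 ce1 bound.
set p := q / (q - 1) in c1 bound *.
have q0 : 0 < q by lra.
have q1 : 0 < q - 1 by lra.
have p0 : 0 < p by rewrite divr_gt0.
have pE : p^-1 = 1 - q^-1 by rewrite /p; field; nz.
set D := \sum_i `|e i| `^ q.
have D0 : 0 <= D by apply: sumr_ge0 => i _; exact: powR_ge0.
have Dgt0 : 0 < D.
  rewrite lt_neqAle D0 andbT eq_sym; apply/eqP => D00.
  have e0 i : e i = 0.
    have /eqP := psumr_eq0P (fun i _ => powR_ge0 _ _) D00 (i := i) isT.
    by rewrite powR_eq0 normr_eq0 => /andP[/eqP].
  move: ce1; rewrite big1 => [/eqP|i _]; last by rewrite e0 mulr0.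
  by rewrite eq_sym oner_eq0.
have D1 : D <= 1.
  (* The dual extremizer of [e], normalized in l^p; its pairing with [e] is D^(1/q). *)
  pose b i := Num.sg (e i) * `|e i| `^ (q - 1) / D `^ p^-1.
  have b1 : \sum_i `|b i| `^ p = 1.
    under eq_bigr => i _.
      rewrite /b normrM normrM normr_sg normfV !(ger0_norm (powR_ge0 _ _)).
      rewrite !powRM ?invr_ge0 ?powR_ge0 ?mulr_ge0 ?ler0n// -powRrM.
      rewrite -powR_inv1 ?powR_ge0// -!powRrM.
      have -> : (q - 1) * p = q by rewrite /p; field; nz.
      have -> : p^-1 * (-1 * p) = -1 by field; nz.
      rewrite powR_inv1//.
      have -> : (e i != 0)%:R `^ p * `|e i| `^ q = `|e i| `^ q.
        have [->|_] := eqVneq (e i) 0; last by rewrite powR1 mul1r.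
        by rewrite normr0 powR0 ?mul0r ?powR0//; nz.
      over.
    by rewrite -mulr_suml mulfV// gt_eqF.
  have := bound b b1.
  have bE i : b i * e i = `|e i| `^ q / D `^ p^-1.
    transitivity ((Num.sg (e i) * e i) * `|e i| `^ (q - 1) / D `^ p^-1).
      by rewrite /b; ring.
    by rewrite -normrEsg mulr_powRB1.
  under eq_bigr do rewrite bE.
  rewrite -mulr_suml -/D -{1}(powRr1 D0) -powRB; last first.
    by apply/implyP => _; rewrite gt_eqF.
  rewrite pE opprB addrC subrK => Dq.
  have : (D `^ q^-1) `^ q <= 1 `^ q.
    by apply: ge0_ler_powR; rewrite ?nnegrE ?powR_ge0//; lra.
  by rewrite powR1 -powRrM mulVf ?powRr1//; nz.
have h i : 0 <= (1 - q^-1) * `|c i| `^ p + q^-1 * `|e i| `^ q - c i * e i.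
  rewrite subr_ge0; apply: le_trans (ler_norm _) _; rewrite normrM.
  have := @conjugate_powR _ `|c i| `|e i| p q (normr_ge0 _) (normr_ge0 _) p0 q0.
  by rewrite pE ![_ / _]mulrC ![_ * (1 - _)]mulrC; apply; ring.
move=> i.
have : \sum_i ((1 - q^-1) * `|c i| `^ p + q^-1 * `|e i| `^ q - c i * e i) <= 0.
  rewrite sumrB big_split/= -!mulr_sumr c1 ce1 -/D.
  have iq : 0 < q^-1 by rewrite invr_gt0.
  have : q^-1 * D <= q^-1 * 1 by rewrite ler_pM2l.
  lra.
rewrite le_eqVlt ltNge sumr_ge0// orbF => /eqP s0.
have /eqP := psumr_eq0P (fun i _ => h i) s0 (i := i) isT.
rewrite subr_eq0 => /eqP hi.
apply: (@young_eq _ _ _ q) => //; rewrite ?powR_ge0// hi.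
rewrite -pE -!powRrM !divff ?powRr1//; [|nz|nz].
by rewrite -normrM ler_norm.
Qed.

Lemma coord_le_norm v i : `|v ord0 i| <= `|v|.
Proof.
rewrite [leRHS]/Num.norm /= mx_normrE.
by apply/bigmax_geP; right => /=; exists (ord0, i).
Qed.

Lemma locally_lipschitz_continuous (f : 'rV[R]_N -> R) :
  (forall K, exists L, forall v w, `|v| <= K -> `|w| <= K ->
     `|f v - f w| <= L * `|v - w|) ->
  continuous f.
Proof.
move=> lf v; have [L Lf] := lf (`|v| + 1).
have FF : Filter (nbhs v) by exact: nbhs_filter.
apply/(@cvgrPdist_le _ _ _ _ FF) => e e0.
near=> w.
have vw : `|v - w| <= Num.min 1 (e / (`|L| + 1)).
  near: w; apply: cvgr_dist_le => //.
  by rewrite lt_min ltr01 divr_gt0// ltr_wpDl.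
move: vw; rewrite le_min => /andP[vw1 vw2].
apply: le_trans (Lf v w _ _) _.
- by rewrite lerDl.
- rewrite -[w](subrK v) -opprB (le_trans (ler_normD _ _))// normrN addrC.
  by rewrite lerD2l.
- apply: le_trans (_ : (`|L| + 1) * `|v - w| <= _).
    by rewrite ler_wpM2r// (le_trans (ler_norm _))// lerDl.
  by rewrite mulrC -ler_pdivlMr// ltr_wpDl.
Unshelve. all: by end_near. Qed.

Lemma power_sphere_le1 p c i : 0 < p -> \sum_j `|c j| `^ p = 1 -> `|c i| <= 1.
Proof.
move=> p0 c1; rewrite leNgt; apply/negP => h.
have : \sum_j `|c j| `^ p > 1.
  rewrite (bigD1 i)//= ltr_wpDr//.
    by apply: sumr_ge0 => j _; exact: powR_ge0.
  by have := @gt0_ltr_powR R p p0 1 `|c i|; rewrite powR1 !nnegrE; apply.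
by rewrite c1 ltxx.
Qed.

Lemma compact_power_sphere p : 1 <= p ->
  compact [set v : 'rV[R]_N | \sum_i `|v ord0 i| `^ p = 1].
Proof.
move=> p1; have p0 : 0 < p by lra.
apply: bounded_closed_compact.
  exists 1; split; first exact: num_real.
  move=> M M1 v /= v1; rewrite /Num.norm/= mx_normrE; apply/bigmax_leP.
  split=> [|[i j] _ /=]; first exact: ltW (lt_trans ltr01 M1).
  by rewrite ord1 (le_trans (power_sphere_le1 j p0 v1) (ltW M1)).
have cf : continuous (fun v : 'rV[R]_N => \sum_i `|v ord0 i| `^ p).
  apply: locally_lipschitz_continuous => K.
  exists (\sum_(i < N) p * K `^ (p - 1)) => v w vK wK.
  rewrite -sumrB mulr_suml; apply: le_trans (ler_norm_sum _ _ _) _.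
  apply: ler_sum => i _.
  apply: le_trans (powR_lipschitz (K := K) _ _ _) _ => //.
  - by rewrite normr_ge0 (le_trans (coord_le_norm _ _)).
  - by rewrite normr_ge0 (le_trans (coord_le_norm _ _)).
  - rewrite ler_wpM2l ?mulr_ge0 ?powR_ge0//; first lra.
    apply: le_trans (ler_dist_dist _ _) _.
    by have := coord_le_norm (v - w) i; rewrite !mxE.
apply: (preimage_closed (D := [set r : R | r = 1])); last exact: closed_eq.
by move=> v _; exact: cf.
Qed.

End finite_sequences.

(** * L^q integrals of combinations of a bounded orthonormal system *)

Section orthonormal_systems.
Context {d : measure_display} {T : measurableType d} {R : realType}.
Variable mu : {measure set T -> \bar R}.
Local Notation sqint := (sqint mu).
Local Notation integrableR := (integrableR mu).
Local Notation ip := (ip mu).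
Implicit Types (f g : T -> R) (q K : R).

Lemma modulus_powR_split a b q : 2 <= q ->
  modulus a b `^ q = modulus a b `^ (q - 2) * (a * a + b * b) :> R.
Proof.
move=> q2; rewrite -!expr2 -sqr_modulus -powR_mulrn ?modulus_ge0//.
by rewrite powR_mul_ge0 ?subrK//; lra.
Qed.

Lemma integrable_modulus_powR f g q K : 2 <= q -> sqint f -> sqint g ->
  (forall x, modulus (f x) (g x) <= K) ->
  integrableR (fun x => modulus (f x) (g x) `^ q).
Proof.
move=> q2 sf sg fgK.
apply: (@le_integrableR _ _ _ _ _
   (fun x => K `^ (q - 2) * (f x * f x + g x * g x))).
- apply: (measurableT_comp (measurable_powR _)).
  by apply: measurable_modulus; [case: sf|case: sg].
- move=> x; rewrite ger0_norm ?powR_ge0// modulus_powR_split//.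
  rewrite ler_wpM2r//; first by rewrite -!expr2 addr_ge0// sqr_ge0.
  apply: ge0_ler_powR; rewrite ?nnegrE ?modulus_ge0 ?subr_ge0//.
  exact: le_trans (modulus_ge0 _ _) (fgK x).
- by apply: integrableRZ; apply: integrableRD; exact: sqintM.
Qed.

Lemma ip_modulus f g : sqint f -> sqint g ->
  \int[mu]_x (f x * f x + g x * g x) = ip f f + ip g g.
Proof. by move=> sf sg; rewrite RintegralD//; exact: sqintM. Qed.

Lemma Rintegral_modulus_powR_le f g q K : 2 <= q -> sqint f -> sqint g ->
  (forall x, modulus (f x) (g x) <= K) ->
  \int[mu]_x (modulus (f x) (g x) `^ q) <= K `^ (q - 2) * (ip f f + ip g g).
Proof.
move=> q2 sf sg fgK; rewrite -ip_modulus// -RintegralZl//; last first.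
  by apply: integrableRD; exact: sqintM.
apply: le_Rintegral => //.
- exact: integrable_modulus_powR fgK.
- by apply: integrableRZ; apply: integrableRD; exact: sqintM.
- move=> x _; rewrite modulus_powR_split//.
  rewrite ler_wpM2r//; first by rewrite -!expr2 addr_ge0// sqr_ge0.
  apply: ge0_ler_powR; rewrite ?nnegrE ?modulus_ge0 ?subr_ge0//.
  exact: le_trans (modulus_ge0 _ _) (fgK x).
Qed.

Section system.
Context {N : nat}.
Implicit Types (c b e : 'I_N -> R).

Definition lc (u : 'I_N -> T -> R) c (x : T) := \sum_i c i * u i x.

(** Stands for complex functions u_i + i v_i. Only the real part of their inner products is
    prescribed, which is all that real coefficients see. *)
Definition orthonormal_pair (u v : 'I_N -> T -> R) :=
  [/\ forall i, sqint (u i), forall i, sqint (v i)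
    & forall i j, ip (u i) (u j) + ip (v i) (v j) = (i == j)%:R].

Variables u v : 'I_N -> T -> R.
Hypothesis uv_orth : orthonormal_pair u v.
Hypothesis uv_bound : forall i x, modulus (u i x) (v i x) <= 1.

Let su i : sqint (u i). Proof. by case: uv_orth. Qed.
Let sv i : sqint (v i). Proof. by case: uv_orth. Qed.
Let orth i j : ip (u i) (u j) + ip (v i) (v j) = (i == j)%:R.
Proof. by case: uv_orth. Qed.

Let slu c : sqint (lc u c). Proof. exact: sqint_sum. Qed.
Let slv c : sqint (lc v c). Proof. exact: sqint_sum. Qed.

Definition lcmod c (x : T) := modulus (lc u c x) (lc v c x).

(** The real part of the inner product of sum c_i (u_i + i v_i) with f + i g. *)
Definition pairing c f g := ip (lc u c) f + ip (lc v c) g.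

Lemma pairing_sum c f g : sqint f -> sqint g ->
  pairing c f g = \sum_i c i * (ip (u i) f + ip (v i) g).
Proof.
move=> sf sg; rewrite /pairing !ip_suml// -big_split/=.
by apply: eq_bigr => i _; rewrite mulrDr.
Qed.

Lemma pairing_coef c i : ip (u i) (lc u c) + ip (v i) (lc v c) = c i.
Proof.
rewrite [X in X + _]ipC [X in _ + X]ipC -/(pairing c _ _) pairing_sum//.
rewrite (bigD1 i)//= orth eqxx mulr1 big1 ?addr0// => j ji.
by rewrite orth (negbTE ji) mulr0.
Qed.

Lemma pairing_lc c b : pairing c (lc u b) (lc v b) = \sum_i c i * b i.
Proof.
by rewrite pairing_sum//; apply: eq_bigr => i _; rewrite pairing_coef.
Qed.

Lemma bessel f g : sqint f -> sqint g ->
  \sum_i (ip (u i) f + ip (v i) g) ^+ 2 <= ip f f + ip g g.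
Proof.
move=> sf sg; pose e i := ip (u i) f + ip (v i) g.
have H w h : sqint w -> sqint h ->
    0 <= ip h h - 2 * ip w h + ip w w.
  move=> sw sh; apply: le_trans (ip_ge0 mu (fun x => h x + -1 * w x)) _.
  have sw' := sqintZ (-1) sw.
  rewrite ipDl//; last exact: sqintD.
  rewrite [X in X + _]ipC [X in _ + X]ipC !ipDl// [ip h (fun x => -1 * w x)]ipC.
  rewrite !ipZl// [ip w (fun x => -1 * w x)]ipC ipZl//.
  by rewrite le_eqVlt; apply/orP; left; apply/eqP; ring.
have h1 := H _ _ (slu e) sf; have h2 := H _ _ (slv e) sg.
have e1 : pairing e f g = \sum_i e i ^+ 2.
  by rewrite pairing_sum//; apply: eq_bigr => i _; rewrite expr2.
have e2 : pairing e (lc u e) (lc v e) = \sum_i e i ^+ 2.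
  by rewrite pairing_lc; apply: eq_bigr => i _; rewrite expr2.
by rewrite /pairing in e1 e2; rewrite -/(e _); lra.
Qed.

Lemma lcmod_le c x : lcmod c x <= \sum_i `|c i|.
Proof.
apply: le_trans (modulus_sum _ _ _ _) _; apply: ler_sum => i _.
by rewrite ler_piMr.
Qed.

Lemma lcmod_ge0 c x : 0 <= lcmod c x. Proof. exact: modulus_ge0. Qed.

Definition lcint q c := \int[mu]_x (lcmod c x `^ q).

Lemma lcint_integrable q c : 2 <= q -> integrableR (fun x => lcmod c x `^ q).
Proof. by move=> q2; apply: integrable_modulus_powR => // x; exact: lcmod_le. Qed.

Lemma lcint_le q c : 2 <= q ->
  lcint q c <= (\sum_i `|c i|) `^ (q - 2) * \sum_i c i ^+ 2.
Proof.
move=> q2; apply: le_trans (Rintegral_modulus_powR_le q2 _ _ (lcmod_le c)) _ => //.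
by rewrite -/(pairing _ _ _) pairing_lc.
Qed.

Lemma lcint_ge0 q c : 0 <= lcint q c.
Proof. by apply: Rintegral_ge0 => x _; exact: powR_ge0. Qed.

Lemma lcZ (w : 'I_N -> T -> R) k c x : lc w (fun i => k * c i) x = k * lc w c x.
Proof. by rewrite mulr_sumr; apply: eq_bigr => i _; rewrite mulrA. Qed.

Lemma lcintZ q k c : 2 <= q ->
  lcint q (fun i => k * c i) = `|k| `^ q * lcint q c.
Proof.
move=> q2; rewrite /lcint -RintegralZl//; last exact: lcint_integrable.
apply: eq_Rintegral => x _.
by rewrite /lcmod !lcZ modulusZ powRM// modulus_ge0.
Qed.

(** Supplies the continuity in the coefficients that makes a maximum on a sphere attained. The
    integrands are compared pointwise by [powR_lipschitz]: [Phi] dominates both moduli and [e * Psi]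
    dominates their difference. *)
Lemma lcint_lipschitz q K : 2 <= q -> exists L, forall c b,
  (forall i, `|c i| <= K) -> (forall i, `|b i| <= K) ->
  forall e : R, (forall i, `|c i - b i| <= e) -> `|lcint q c - lcint q b| <= L * e.
Proof.
move=> q2.
pose Phi x := \sum_i `|K| * modulus (u i x) (v i x).
pose Psi x := \sum_i 1 * modulus (u i x) (v i x).
have Phi_ge0 x : 0 <= Phi x.
  by apply: sumr_ge0 => i _; rewrite mulr_ge0 ?modulus_ge0.
have smod i : sqint (fun x => modulus (u i x) (v i x)).
  split; first by apply: measurable_modulus; [case: (su i)|case: (sv i)].
  have := integrableRD (su i).2 (sv i).2.
  by congr integrableR; apply/funext => x; rewrite sqr_modulus.
have sPsi : sqint Psi by exact: sqint_sum.
have mPhi : measurable_fun setT Phi by have [] := sqint_sum (index_enum 'I_N) (fun=> `|K|) smod.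
have PhiN x : Phi x <= N%:R * `|K|.
  apply: le_trans (_ : \sum_(i < N) `|K| <= _).
    by apply: ler_sum => i _; rewrite ler_piMr.
  by rewrite sumr_const card_ord mulr_natl.
have PsiN x : Psi x <= N%:R.
  apply: le_trans (_ : \sum_(i < N) 1 <= _).
    by apply: ler_sum => i _; rewrite mul1r.
  by rewrite sumr_const card_ord.
have Psi_ge0 x : 0 <= Psi x.
  by apply: sumr_ge0 => i _; rewrite mulr_ge0 ?modulus_ge0.
have PhiPsi x : Phi x = `|K| * Psi x.
  by rewrite mulr_sumr; apply: eq_bigr => i _; rewrite mul1r.
(* Since [mu] may be infinite, boundedness does not give integrability: two factors [Psi] are kept
   for the square integral, and the other [q - 2] are bounded through [N]. *)
have iPP : integrableR (fun x => q * Phi x `^ (q - 1) * Psi x).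
  apply: (@le_integrableR _ _ _ _ _
     (fun x => q * `|K| `^ (q - 1) * N%:R `^ (q - 2) * (Psi x ^+ 2))).
  - apply: measurable_funM; last by case: sPsi.
    apply: measurable_funM => //.
    exact: (measurableT_comp (measurable_powR _)).
  - move=> x; rewrite PhiPsi powRM// ger0_norm; last first.
      by rewrite !mulr_ge0 ?powR_ge0//; lra.
    have -> : Psi x `^ (q - 1) = Psi x `^ (q - 2) * Psi x.
      rewrite -{3}(powRr1 (Psi_ge0 x)) powR_mul_ge0//; last lra.
      by congr powR; ring.
    rewrite [leLHS](_ : _ = q * `|K| `^ (q - 1) * Psi x ^+ 2 * Psi x `^ (q - 2)); last by ring.
    rewrite [leRHS](_ : _ = q * `|K| `^ (q - 1) * Psi x ^+ 2 * N%:R `^ (q - 2)); last by ring.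
    rewrite ler_wpM2l//; first by rewrite !mulr_ge0 ?powR_ge0//; lra.
    by apply: ge0_ler_powR; rewrite ?nnegrE//; lra.
  - by apply: integrableRZ; case: sPsi.
exists (\int[mu]_x (q * Phi x `^ (q - 1) * Psi x)) => c b cK bK e cbe.
have mod_le c' : (forall i, `|c' i| <= K) -> forall x, lcmod c' x <= Phi x.
  move=> c'K x; apply: le_trans (modulus_sum _ _ _ _) _; apply: ler_sum => i _.
  by rewrite ler_wpM2r ?modulus_ge0// (le_trans (c'K i))// ler_norm.
rewrite -RintegralB//; [|exact: lcint_integrable|exact: lcint_integrable].
rewrite -RintegralZr//.
apply: le_trans (le_normr_Rintegral _ _) _ => //.
  have := integrableRD (lcint_integrable c q2) (integrableRZ (-1) (lcint_integrable b q2)).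
  by congr integrableR; apply/funext => x; rewrite mulN1r.
have idiff : integrableR (fun x => lcmod c x `^ q - lcmod b x `^ q).
  have := integrableRD (lcint_integrable c q2) (integrableRZ (-1) (lcint_integrable b q2)).
  by congr integrableR; apply/funext => x; rewrite mulN1r.
apply: le_Rintegral => //.
- exact: (integrable_abse idiff).
- have := integrableRZ e iPP.
  by congr integrableR; apply/funext => x; rewrite mulrC.
- move=> x _; apply: le_trans (powR_lipschitz (K := Phi x) _ _ _) _.
  + by rewrite lcmod_ge0 mod_le.
  + by rewrite lcmod_ge0 mod_le.
  + lra.
  + rewrite -[leRHS]mulrA ler_wpM2l// ?mulr_ge0 ?powR_ge0//; first lra.
    apply: le_trans (modulusB _ _ _ _) _.
    rewrite /lc -!sumrB.
    under eq_bigr do rewrite -mulrBl.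
    under [X in modulus _ X]eq_bigr do rewrite -mulrBl.
    apply: le_trans (modulus_sum _ _ _ _) _.
    rewrite mulr_suml; apply: ler_sum => i _.
    by rewrite mul1r mulrC ler_wpM2l ?modulus_ge0.
Qed.

End system.
End orthonormal_systems.

(** * The inequality of F. Riesz with constant 1 *)

Section riesz.
Context {d : measure_display} {T : measurableType d} {R : realType}.
Variable mu : {measure set T -> \bar R}.
Local Notation sqint := (sqint mu).
Local Notation integrableR := (integrableR mu).
Local Notation ip := (ip mu).
Context {N : nat}.
Implicit Types (c b e : 'I_N -> R) (q A : R).

Variables u v : 'I_N -> T -> R.
Hypothesis uv_orth : orthonormal_pair mu u v.
Hypothesis uv_bound : forall i x, modulus (u i x) (v i x) <= 1.
Local Notation lcint := (lcint mu u v).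
Local Notation lcmod := (lcmod u v).
Let su i : sqint (u i). Proof. by case: uv_orth. Qed.
Let sv i : sqint (v i). Proof. by case: uv_orth. Qed.
Let slu c : sqint (lc u c). Proof. exact: sqint_sum. Qed.
Let slv c : sqint (lc v c). Proof. exact: sqint_sum. Qed.

(** One [A] serves all exponents at once, because improving it at [q] consumes the bound at
    [2 * q - 2]. *)
Definition hausdorff_young_bound A := forall q c, 2 < q ->
  \sum_i `|c i| `^ (q / (q - 1)) = 1 -> lcint q c <= A.

(** On the sphere |c_i| <= 1 and p < 2, so the squares of the c_i sum to at most 1; by Jensen's
    inequality the |c_i| sum to at most N^(1/q). The supremum of the combination and its L^2 norm
    then give N^((q-2)/q) <= N. *)
Lemma hausdorff_young_bound0 : hausdorff_young_bound N%:R.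
Proof.
move=> q c q2 c1; set p := q / (q - 1) in c1.
have p1 : 1 < p by rewrite ltr_pdivlMr//; lra.
have p2 : p < 2 by rewrite ltr_pdivrMr//; lra.
have N0 : (0 < N)%N.
  case: (posnP N) => // N0; move: c1; rewrite big1 => [/eqP|i _].
    by rewrite eq_sym oner_eq0.
  by have := leq_trans (ltn_ord i) (eq_leq N0).
have NR : 1 <= N%:R :> R by rewrite ler1n.
have c_le1 i : `|c i| <= 1.
  by apply: power_sphere_le1 c1; rewrite (lt_trans ltr01).
have s2 : \sum_i c i ^+ 2 <= 1.
  rewrite -c1; apply: ler_sum => i _.
  have [->|ci0] := eqVneq (c i) 0; first by rewrite expr0n powR_ge0.
  rewrite -real_normK ?num_real// -powR_mulrn//.
  by apply: ger_powR; rewrite ?c_le1 ?normr_gt0 ?ci0//; lra.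
have s1 : \sum_i `|c i| <= N%:R `^ q^-1.
  have := @powR_jensen _ _ (fun _ : 'I_N => N%:R^-1) (fun i => `|c i|) p (ltW p1).
  rewrite -!mulr_sumr c1 mulr1.
  have w1 : \sum_(i < N) (N%:R : R)^-1 = 1.
    by rewrite sumr_const card_ord -(mulr_natl (N%:R)^-1 N) mulfV// gt_eqF// ltr0n.
  have w0 : 0 <= (N%:R : R)^-1 by rewrite invr_ge0 ler0n.
  move=> /(_ (fun=> w0) w1 (fun i => normr_ge0 _)) h.
  have s0 : 0 <= \sum_i `|c i| by exact: sumr_ge0.
  have : (N%:R * (N%:R^-1 * \sum_i `|c i|)) `^ p <= (N%:R `^ q^-1) `^ p.
    rewrite powRM//; last by rewrite mulr_ge0.
    apply: le_trans (ler_wpM2l (powR_ge0 _ _) h) _.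
    rewrite -powR_inv1// -powRD; last by apply/implyP => _; nz.
    rewrite -powRrM; have -> // : p + -1 = q^-1 * p by rewrite /p; field; nz.
  rewrite mulVKf; last by apply: lt0r_neq0; exact: lt_le_trans NR.
  move=> h'; have p0 : 0 < p by lra.
  rewrite leNgt; apply/negP => h2; move: h'; rewrite leNgt => /negP; apply.
  by apply: gt0_ltr_powR; rewrite ?nnegrE ?powR_ge0.
apply: le_trans (lcint_le uv_orth uv_bound c (ltW q2)) _.
have -> : N%:R = N%:R * 1 :> R by rewrite mulr1.
apply: ler_pM => //; first exact: powR_ge0.
  by apply: sumr_ge0 => i _; exact: sqr_ge0.
apply: (@le_trans _ _ ((N%:R `^ q^-1) `^ (q - 2))).
  by apply: ge0_ler_powR; rewrite ?nnegrE ?powR_ge0 ?sumr_ge0//; lra.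
rewrite -powRrM -[leRHS]powRr1//; apply: ler_powR => //.
by rewrite ler_pdivrMl; lra.
Qed.

Lemma hausdorff_young_bound_homogeneous A : hausdorff_young_bound A ->
  forall q c, 2 < q ->
  lcint q c <= A * (\sum_i `|c i| `^ (q / (q - 1))) `^ (q - 1).
Proof.
move=> hy q c q2; set p := q / (q - 1).
have p0 : 0 < p by rewrite divr_gt0; lra.
set P := \sum_i _.
have P0 : 0 <= P by apply: sumr_ge0 => i _; exact: powR_ge0.
have [P00|P0'] := eqVneq P 0.
  (* The zero sequence is written as a product so that [lcintZ] applies with factor [0]. *)
  have c0 i : c i = 0 * 0.
    have /eqP := psumr_eq0P (fun i _ => powR_ge0 _ _) P00 (i := i) isT.
    by rewrite mulr0 powR_eq0 normr_eq0 => /andP[/eqP].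
  rewrite (_ : c = fun i => 0 * 0); last exact/funext.
  rewrite (lcintZ uv_orth uv_bound)// ?(ltW q2)// normr0 P00 !powR0 ?mul0r ?mulr0//; nz.
have Pgt0 : 0 < P by rewrite lt_neqAle eq_sym P0'.
pose k := P `^ (- p^-1).
have k0 : 0 <= k by exact: powR_ge0.
have := hy q (fun i => k * c i) q2.
rewrite (lcintZ uv_orth uv_bound)// ?(ltW q2)// ger0_norm//.
under eq_bigr do rewrite normrM powRM// ger0_norm//.
rewrite -mulr_sumr -/p -/P.
have -> : k `^ p = P `^ (-1).
  by rewrite /k -powRrM; congr powR; field; nz.
rewrite powR_inv1// mulVf// => /(_ erefl).
have -> : k `^ q = (P `^ (q - 1))^-1.
  rewrite /k -powRrM -powRN; congr powR; rewrite /p; field; nz.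
rewrite ler_pdivrMl ?powR_gt0//.
by rewrite mulrC.
Qed.

(* At a maximizer c of lcint q on the sphere, the equality case of Hoelder's
   inequality forces the coefficients of |f|^(q-2) f to be proportional to
   |c|^(p-1), p = q / (q - 1); Bessel's inequality then bounds the square of the
   maximum by the same problem for r = 2q - 2 and r / (r - 1). *)
Lemma hausdorff_young_bound_sqrt A : hausdorff_young_bound A ->
  hausdorff_young_bound (Num.sqrt A).
Proof.
move=> hy q c0 q2 c01; set p := q / (q - 1) in c01 *.
have q0 : 0 < q by lra.
have p1 : 1 < p by rewrite ltr_pdivlMr//; lra.
have p0 : 0 < p by lra.
have pqE : p^-1 + q^-1 = 1 by rewrite /p; field; nz.
have [c [c1 cmax]] : exists c, \sum_i `|c i| `^ p = 1 /\
    forall b, \sum_i `|b i| `^ p = 1 -> lcint q b <= lcint q c.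
  pose J (w : 'rV[R]_N) := lcint q (fun i => w ord0 i).
  have cJ : continuous J.
    apply: locally_lipschitz_continuous => K.
    have [L HL] := lcint_lipschitz uv_orth uv_bound K (ltW q2).
    exists L => w z wK zK; apply: HL => i.
    - exact: le_trans (coord_le_norm _ _) wK.
    - exact: le_trans (coord_le_norm _ _) zK.
    - by have := coord_le_norm (w - z) i; rewrite !mxE.
  have [||w wS wmax] := EVT_max_rV (f := J) _ (compact_power_sphere (N := N) (ltW p1)).
  - exists (\row_i c0 i) => /=; rewrite -c01; apply: eq_bigr => i _.
    by rewrite mxE.
  - exact: continuous_subspaceT.
  exists (fun i => w ord0 i); split; first by rewrite inE in wS.
  move=> b b1; have := wmax (\row_i b i).
  rewrite inE /J /=.
  have -> : (fun i => (\row_i b i) ord0 i) = b by apply/funext => i; rewrite mxE.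
  by apply; rewrite -b1; apply: eq_bigr => i _; rewrite mxE.
apply: le_trans (cmax _ c01) _.
set M := lcint q c in cmax *.
have M0 : 0 <= M by exact: lcint_ge0.
have [->|M0'] := eqVneq M 0; first exact: sqrtr_ge0.
have Mgt0 : 0 < M by rewrite lt_neqAle eq_sym M0'.
(* With f the combination with coefficients [c], g1 + i g2 is |f|^(q-2) f: it pairs with f to [M],
   and its squared modulus is |f|^(2q-2). *)
pose g1 x := lcmod c x `^ (q - 2) * lc u c x.
pose g2 x := lcmod c x `^ (q - 2) * lc v c x.
have mlc : measurable_fun setT (lcmod c).
  by apply: measurable_modulus; [case: (slu c)|case: (slv c)].
have gE x : g1 x ^+ 2 + g2 x ^+ 2 = lcmod c x `^ (2 * q - 2).
  rewrite /g1 /g2 !exprMn -mulrDr -sqr_modulus -/(lcmod c x).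
  rewrite -exprMn -[X in (_ * X) ^+ _]powRr1 ?lcmod_ge0//.
  rewrite powR_mul_ge0//; last lra.
  rewrite -powR_mulrn ?powR_ge0// -powRrM; congr powR; ring.
have q22 : 2 <= 2 * q - 2 by lra.
have ig := lcint_integrable uv_orth uv_bound c q22.
have sg1 : sqint g1.
  have m1 : measurable_fun setT g1.
    apply: measurable_funM; last by case: (slu c).
    exact: (measurableT_comp (measurable_powR _)).
  split => //; apply: le_integrableR ig; first exact: measurable_funX.
  by move=> x; rewrite -gE ger0_norm ?sqr_ge0// lerDl sqr_ge0.
have sg2 : sqint g2.
  have m2 : measurable_fun setT g2.
    apply: measurable_funM; last by case: (slv c).
    exact: (measurableT_comp (measurable_powR _)).
  split => //; apply: le_integrableR ig; first exact: measurable_funX.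
  by move=> x; rewrite -gE ger0_norm ?sqr_ge0// lerDr sqr_ge0.
have gg : ip g1 g1 + ip g2 g2 = lcint (2 * q - 2) c.
  rewrite -ip_modulus//; apply: eq_Rintegral => x _.
  by rewrite -!expr2 gE.
pose D i := ip (u i) g1 + ip (v i) g2.
have pairD b : pairing mu u v b g1 g2 = \sum_i b i * D i by rewrite pairing_sum.
have cD : \sum_i c i * D i = M.
  rewrite -pairD /pairing -RintegralD//; [|exact: sqintM|exact: sqintM].
  apply: eq_Rintegral => x _; rewrite /lcmod modulus_powR_split; last lra.
  rewrite /g1 /g2 /lcmod; ring.
have bD b : \sum_i `|b i| `^ p = 1 -> \sum_i b i * D i <= M.
  move=> b1; rewrite -pairD /pairing -RintegralD//; [|exact: sqintM|exact: sqintM].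
  have iq a := lcint_integrable uv_orth uv_bound a (ltW q2).
  (* Young's inequality under the integral leaves a weighted mean of [lcint q c] and [lcint q b],
     and the latter is at most [M] by maximality. *)
  apply: (@le_trans _ _ (\int[mu]_x ((1 - q^-1) * (lcmod c x `^ q)
                                      + q^-1 * (lcmod b x `^ q)))).
    apply: le_Rintegral => //.
    - by apply: integrableRD; exact: sqintM.
    - by apply: integrableRD; apply: integrableRZ; exact: iq.
    - move=> x _; apply: le_trans (powR_tangent _ _ _); rewrite ?lcmod_ge0//; last lra.
      rewrite /g1 /g2.
      rewrite [leLHS](_ : _ = lcmod c x `^ (q - 2) *
        (lc u b x * lc u c x + lc v b x * lc v c x)); last by ring.
      have -> : q - 1 = q - 2 + 1 by ring.
      rewrite -(@powR_mul_ge0 _ _ (q - 2) 1)//; last lra.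
      rewrite powRr1 ?lcmod_ge0// -mulrA ler_wpM2l ?powR_ge0//.
      by rewrite [leRHS]mulrC (le_trans (ler_norm _))// modulus_dot.
  rewrite RintegralD//; [|exact/integrableRZ/iq|exact/integrableRZ/iq].
  rewrite !RintegralZl//; [|exact/iq|exact/iq].
  rewrite -/(lcint q c) -/(lcint q b) -/M.
  have mean (k X Y : R) : 0 <= k -> X <= Y -> (1 - k) * Y + k * X <= Y.
    move=> k0 XY; have : k * X <= k * Y by rewrite ler_wpM2l.
    by lra.
  apply: mean (cmax b b1).
  by rewrite invr_ge0 ltW.
have ext : forall i, `|c i| `^ p = `|M^-1 * D i| `^ q.
  apply: powR_dual_extremal => //; first exact: ltW.
    under eq_bigr do rewrite mulrCA.
    by rewrite -mulr_sumr cD mulVf.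
  move=> b b1; under eq_bigr do rewrite mulrCA.
  by rewrite -mulr_sumr mulrC ler_pdivrMr// mul1r bD.
have DE i : D i ^+ 2 = M ^+ 2 * `|c i| `^ (2 * (p - 1)).
  have -> : D i = M * (M^-1 * D i) by rewrite mulVKf.
  rewrite exprMn; congr (_ * _).
  rewrite -real_normK ?num_real// -powR_mulrn//.
  have -> : 2 * (p - 1) = p * (q^-1 * 2) by rewrite /p; field; nz.
  by rewrite powRrM ext -powRrM mulrA divff ?mul1r//; nz.
set Q := \sum_i `|c i| `^ (2 * (p - 1)).
have Qgt0 : 0 < Q.
  rewrite lt_neqAle sumr_ge0 ?andbT => [|i _]; last exact: powR_ge0.
  rewrite eq_sym; apply/eqP => Q0.
  move: cD; rewrite big1 => [/eqP|i _]; first by rewrite eq_sym (negbTE M0').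
  have := psumr_eq0P (fun i _ => powR_ge0 _ _) Q0 (i := i) isT.
  have := DE i => /[swap] -> /eqP; rewrite mulr0 sqrf_eq0 => /eqP ->.
  by rewrite mulr0.
have A0 : 0 <= A.
  apply: le_trans (hy q c0 q2 c01); exact: lcint_ge0.
suff : M ^+ 2 * Q <= A * Q.
  rewrite ler_pM2r// => MA.
  by rewrite -(ger0_norm M0) -sqrtr_sqr ler_wsqrtr.
rewrite [leLHS]mulr_sumr; under eq_bigr do rewrite -DE.
apply: le_trans (bessel uv_orth sg1 sg2) _; rewrite gg.
apply: le_trans (hausdorff_young_bound_homogeneous hy _ _) _; first lra.
rewrite ler_wpM2l//.
set r' := _ / (2 * q - 2 - 1).
pose y := p - r'.
have yE : y = (q - 2) / ((q - 1) * (2 * q - 3)).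
  rewrite /y /p /r'; field.
  by apply/andP; split; nz.
have t1 : 1 <= 2 * q - 3 by lra.
(* The weights |c_i|^p have sum 1. Against the values |c_i|^(-y), the mean is the sum of the
   |c_i|^r', and the mean of the powers of exponent 2q - 3 is [Q]. *)
have jen := powR_jensen t1 (fun i => powR_ge0 `|c i| p) c1
  (fun i => powR_ge0 `|c i| (- y)).
have cpow t i : p + t != 0 -> `|c i| `^ p * `|c i| `^ t = `|c i| `^ (p + t).
  by move=> pt; rewrite powRD// (negbTE pt).
have r'0 : 0 < r' by rewrite /r' divr_gt0//; lra.
have e1 : \sum_i `|c i| `^ p * `|c i| `^ (- y) = \sum_i `|c i| `^ r'.
  apply: eq_bigr => i _.
  have yr : p + - y = r' by rewrite /y opprB addrC subrK.
  by rewrite cpow yr//; exact: lt0r_neq0.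
have e2 : \sum_i `|c i| `^ p * (`|c i| `^ (- y)) `^ (2 * q - 3) = Q.
  apply: eq_bigr => i _; rewrite -powRrM.
  have e : p + - y * (2 * q - 3) = 2 * (p - 1).
    by rewrite yE /p; field; apply/andP; split; nz.
  by rewrite cpow e//; apply: lt0r_neq0; lra.
rewrite e1 e2 in jen.
have -> : 2 * q - 2 - 1 = 2 * q - 3 by ring.
exact: jen.
Qed.

(** If some normalized [c] had an integral J > 1, iterating the square root would give J^(2^n) <= N
    for all n. Bernoulli's inequality turns this into 1 + n (J - 1) <= N, which fails for large
    n. *)
Lemma hausdorff_young q c : 2 < q ->
  lcint q c <= (\sum_i `|c i| `^ (q / (q - 1))) `^ (q - 1).
Proof.
move=> q2; rewrite -[leRHS]mul1r.
apply: (@hausdorff_young_bound_homogeneous 1) => // {q2}{}q {}c q2 c1.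
rewrite leNgt; apply/negP => J1; set J := lcint q c in J1.
have hyn n : exists2 A, hausdorff_young_bound A & 0 <= A /\ A ^+ (2 ^ n) <= N%:R.
  elim: n => [|n [A hA [A0 An]]].
    by exists N%:R; [exact: hausdorff_young_bound0|rewrite expr1].
  exists (Num.sqrt A); first exact: hausdorff_young_bound_sqrt.
  by rewrite sqrtr_ge0 expnS exprM sqr_sqrtr.
have Jn n : 1 + (J - 1) *+ n <= N%:R.
  have [A hA [A0 An]] := hyn n.
  apply: le_trans (An).
  apply: (@le_trans _ _ (J ^+ (2 ^ n))); last first.
    by rewrite lerXn2r ?nnegrE ?(hA q c)//; lra.
  apply: (@le_trans _ _ (J ^+ n)); last first.
    by rewrite ler_weXn2l ?(ltW J1)// ltnW// ltn_expl.
  clear A hA A0 An; elim: n => [|n ih]; first by rewrite mulr0n addr0 expr0.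
  rewrite exprS mulrSr; apply: le_trans (ler_wpM2l _ ih); last lra.
  have : 0 <= (J - 1) *+ n by rewrite mulrn_wge0//; lra.
  set t := _ *+ n => t0.
  have : 0 <= (J - 1) * t by rewrite mulr_ge0//; lra.
  by lra.
have J10 : 0 < J - 1 by lra.
have := Jn (Num.bound (N%:R / (J - 1))).
have : N%:R / (J - 1) < (Num.bound (N%:R / (J - 1)))%:R.
  by apply: archi_boundP; rewrite divr_ge0//; lra.
by rewrite ltr_pdivrMr// mulrC mulr_natr; lra.
Qed.

End riesz.

(** * Singular values under rank one perturbations *)

Section inner_product.
Context {R : realType} {H : hilbertType R}.
Local Notation C := (Cplx R).
Implicit Types (u v w x y e : H) (a : C).

Lemma dotDl u v w : dot (u + v) w = dot u w + dot v w.
Proof. by have := dotPl 1 u v w; rewrite scale1r mul1r. Qed.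

Lemma dot0l w : dot 0 w = 0 :> C.
Proof. by apply: (addrI (dot 0 w)); rewrite -dotDl !addr0. Qed.

Lemma dotZl a u w : dot (a *: u) w = a * dot u w.
Proof. by have := dotPl a u 0 w; rewrite addr0 dot0l addr0. Qed.

Lemma dotNl u w : dot (- u) w = - dot u w.
Proof. by rewrite -scaleN1r dotZl mulN1r. Qed.

Lemma dotBl u v w : dot (u - v) w = dot u w - dot v w.
Proof. by rewrite dotDl dotNl. Qed.

Lemma dot_suml I (r : seq I) (F : I -> H) w :
  dot (\sum_(i <- r) F i) w = \sum_(i <- r) dot (F i) w.
Proof.
elim: r => [|i r ih]; first by rewrite !big_nil dot0l.
by rewrite !big_cons dotDl ih.
Qed.

Lemma dot0r w : dot w 0 = 0 :> C.
Proof. by rewrite dotC dot0l conjC0. Qed.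

Lemma dotDr u v w : dot w (u + v) = dot w u + dot w v.
Proof. by rewrite dotC dotDl rmorphD/= -!dotC. Qed.

Lemma dotZr a u w : dot w (a *: u) = a^* * dot w u.
Proof. by rewrite dotC dotZl rmorphM/= -dotC. Qed.

Lemma dotNr u w : dot w (- u) = - dot w u.
Proof. by rewrite dotC dotNl rmorphN/= -dotC. Qed.

Lemma dotBr u v w : dot w (u - v) = dot w u - dot w v.
Proof. by rewrite dotDr dotNr. Qed.

Lemma dot_sumr I (r : seq I) (F : I -> H) w :
  dot w (\sum_(i <- r) F i) = \sum_(i <- r) dot w (F i).
Proof.
elim: r => [|i r ih]; first by rewrite !big_nil dot0r.
by rewrite !big_cons dotDr ih.
Qed.

Lemma dot_eq0 u : dot u u = 0 -> u = 0.
Proof. by rewrite dotE => /eqP; rewrite sqrf_eq0 normr_eq0 => /eqP. Qed.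

Lemma dot_ge0 u : 0 <= dot u u.
Proof. by rewrite dotE exprn_ge0. Qed.

Lemma dot_unit e : `|e| = 1 -> dot e e = 1.
Proof. by move=> e1; rewrite dotE e1 expr1n. Qed.

Lemma dot_inj u v : (forall x, dot x u = dot x v) -> u = v.
Proof.
move=> uv; apply/subr0_eq/dot_eq0; rewrite dotBr; apply/eqP.
by rewrite subr_eq0 uv.
Qed.

Lemma dot_sym0 u v : dot u v = 0 -> dot v u = 0 :> C.
Proof. by move=> uv; rewrite dotC uv conjC0. Qed.

Lemma orthonormal_unit N (g : 'I_N -> H) :
  (forall i j, dot (g i) (g j) = (i == j)%:R) -> forall i, `|g i| = 1.
Proof.
move=> og i; have := og i i; rewrite eqxx dotE => /eqP.
rewrite sqrf_eq1 => /orP[/eqP//|/eqP h].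
by have := normr_ge0 (g i); rewrite h oppr_ge0 ler10.
Qed.

Lemma bessel_step u v : `|v| = 1 \/ v = 0 ->
  dot (u - dot u v *: v) (u - dot u v *: v) = dot u u - `|dot u v| ^+ 2.
Proof.
move=> v1; rewrite !dotBl !dotBr !dotZl !dotZr normCK (dotC v u).
case: v1 => [/dot_unit ->|->]; last by rewrite !dot0l !dot0r; ring.
by ring.
Qed.

Lemma norm_dot_unit u v : `|v| = 1 -> `|dot u v| <= `|u|.
Proof.
move=> v1; rewrite -ler_sqr ?nnegrE// -dotE -subr_ge0.
by rewrite -(bessel_step _ (or_introl v1)) dot_ge0.
Qed.

Lemma bessel_seq (I : eqType) (r : seq I) (e : I -> H) u : uniq r ->
  (forall i j, i != j -> dot (e i) (e j) = 0) ->
  (forall i, `|e i| = 1 \/ e i = 0) ->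
  \sum_(i <- r) `|dot u (e i)| ^+ 2 <= `|u| ^+ 2.
Proof.
move=> + orth unit; rewrite -dotE.
elim: r u => [|i r ih] u; first by rewrite big_nil dot_ge0.
rewrite big_cons => /andP[ir ur].
rewrite addrC -lerBrDr -(bessel_step u (unit i)).
apply: le_trans (ih (u - dot u (e i) *: e i) ur).
rewrite !big_seq; apply: ler_sum => j jr.
rewrite dotBl dotZl orth ?mulr0 ?subr0//.
by apply: contraNneq ir => ->.
Qed.

End inner_product.

Section operators_lemmas.
Context {R : realType} {H : hilbertType R}.
Local Notation C := (Cplx R).
Implicit Types (u v w x y e f : H) (a : C) (T A L : H -> H) (V W : set H).

Lemma linear_at0 T : linear T -> T 0 = 0.
Proof.
move=> lT; have := lT (-1) 0 0.
by rewrite scaler0 addr0 scaleN1r addNr.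
Qed.

Lemma linear_atD T u v : linear T -> T (u + v) = T u + T v.
Proof. by move=> lT; have := lT 1 u v; rewrite !scale1r. Qed.

Lemma linear_atZ T a u : linear T -> T (a *: u) = a *: T u.
Proof. by move=> lT; have := lT a u 0; rewrite (linear_at0 lT) !addr0. Qed.

Lemma linear_atB T u v : linear T -> T (u - v) = T u - T v.
Proof. by move=> lT; rewrite -scaleN1r linear_atD// linear_atZ// scaleN1r. Qed.

Lemma linear_at_sum T I (r : seq I) (F : I -> H) : linear T ->
  T (\sum_(i <- r) F i) = \sum_(i <- r) T (F i).
Proof.
move=> lT; elim: r => [|i r ih]; first by rewrite !big_nil linear_at0.
by rewrite !big_cons linear_atD// ih.
Qed.

Lemma adjoint_spec T y z : (forall x, dot (T x) y = dot x z) ->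
  adjoint T y = z.
Proof.
move=> h; rewrite /adjoint; apply: xget_unique => // z' h'.
by apply: dot_inj => x; rewrite -h -h'.
Qed.

(* The junk value of adjoint is 0, so any nonzero value represents; this is
   what makes the Riesz representation theorem unnecessary. *)
Lemma adjoint_neq0 T y : adjoint T y != 0 ->
  forall x, dot (T x) y = dot x (adjoint T y).
Proof.
rewrite /adjoint; case: xgetP => [z -> //|_].
by rewrite eqxx.
Qed.

(** The weak form of T^* T v = r^2 v, free of [adjoint] and hence of its default value. *)
Definition eigenspace_gram T (r : R) : set H :=
  [set v | forall x, dot (T x) (T v) = ((r ^+ 2)%:C)%C * dot x v].

(** For r > 0 and v nonzero, r^2 v is nonzero, so an eigenvector never meets the default value of
    [adjoint]. *)
Lemma singular_multiplicityE T r : linear T -> 0 < r ->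
  singular_multiplicity T r = vdim (eigenspace_gram T r).
Proof.
move=> lT r0; congr vdim; apply/seteqP; split=> v /=.
  move=> Tv x.
  have [->|v0] := eqVneq v 0; first by rewrite linear_at0// !dot0r mulr0.
  rewrite adjoint_neq0 Tv; last first.
    by rewrite scaler_eq0 (negbTE v0) orbF eq_complex/= eqxx andbT sqrf_eq0 gt_eqF.
  rewrite dotZr; congr (_ * _).
  by apply/CrealP; rewrite ger0_real// ler0c sqr_ge0.
move=> Tv; apply: adjoint_spec => x; rewrite Tv dotZr; congr (_ * _).
by apply/esym/CrealP; rewrite ger0_real// ler0c sqr_ge0.
Qed.

(** The image of the unit ball lies in [K] times the closure of its image under [T]. Every
    perturbation of [T] used later factors as [T \o L], so this is the source of its compactness. *)
Lemma compact_operator_comp T L (K : C) : compact_operator T -> linear L ->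
  (forall v, `|L v| <= K * `|v|) -> compact_operator (T \o L).
Proof.
move=> [lT cT] lL bL; split.
  by move=> a u v /=; rewrite lL lT.
have [K0|K0] := eqVneq K 0.
  have L0 v : L v = 0.
    by apply/eqP; rewrite -normr_le0 (le_trans (bL v))// K0 mul0r.
  have : precompact [set (0 : H)].
    apply: compact_precompact; first exact: norm_hausdorff.
    exact: compact_set1.
  by apply: precompact_subset => _ [v _ <-] /=; rewrite L0 linear_at0.
have : precompact [set K *: x | x in closure [set T v | v in [set v : H | `|v| <= 1]]].
  apply: compact_precompact; first exact: norm_hausdorff.
  apply: continuous_compact; last by rewrite -precompactE.
  by apply: continuous_subspaceT => x; exact: scaler_continuous.
apply: precompact_subset => _ [v /= v1 <-].
exists (K^-1 *: T (L v)); last by rewrite scalerA mulfV// scale1r.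
apply: subset_closure; exists (K^-1 *: L v); last by rewrite linear_atZ.
rewrite /= normrZ normfV.
have Kp : 0 <= K * `|v| by exact: le_trans (bL v).
have [->|v0] := eqVneq (L v) 0; first by rewrite normr0 mulr0 ler01.
have K1 : 0 < K * `|v|.
  by apply: lt_le_trans (bL v); rewrite normr_gt0.
have v'0 : 0 < `|v|.
  rewrite normr_gt0; apply: contraNneq v0 => ->; by rewrite linear_at0.
have Kgt0 : 0 < K by rewrite -(pmulr_lgt0 _ v'0).
rewrite (gtr0_norm Kgt0) mulrC ler_pdivrMr// mul1r.
by apply: le_trans (bL v) _; rewrite ler_piMr// ltW.
Qed.

End operators_lemmas.

(** * Dimension of subspaces and adjunction of an orthogonal vector *)

Section dimension.
Context {R : realType} {H : hilbertType R}.
Local Notation C := (Cplx R).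
Implicit Types (u v w x y e f : H) (a : C) (T A L : H -> H) (V W : set H).

Definition linear_subspace V := V 0 /\ forall a u v, V u -> V v -> V (a *: u + v).

Lemma le_vdim V n (v : 'I_n -> H) : (forall i, V (v i)) ->
  linearly_independent v -> (n%:R%:E <= vdim V)%E.
Proof. by move=> Vv iv; apply: ereal_sup_ubound; exists n => //; exists v. Qed.

Lemma vdim_ge0 V : (0 <= vdim V)%E.
Proof.
have v0 : 'I_0 -> H by case.
by apply: (@le_vdim V 0 v0) => [[]//|c _ []].
Qed.

Lemma vdim_le V (b : \bar R) : (forall n (v : 'I_n -> H), (forall i, V (v i)) ->
  linearly_independent v -> (n%:R%:E <= b)%E) -> (vdim V <= b)%E.
Proof. by move=> h; apply: ge_ereal_sup => _ [n [v [Vv iv]] <-]; exact: h iv. Qed.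

Lemma vdim_set0 : vdim [set (0 : H)] = 0%E.
Proof.
apply/eqP; rewrite eq_le vdim_ge0 andbT; apply: vdim_le => -[|n] v v0 iv //.
have := iv (fun=> 1) _ ord0; rewrite big1 => [/(_ erefl)/eqP|i _].
  by rewrite oner_eq0.
by rewrite v0 scaler0.
Qed.

(** One step of Gaussian elimination: a pivot [v j] not orthogonal to [e] clears the component along
    [e] of the other vectors and is dropped. *)
Lemma independent_project n (v : 'I_n.+1 -> H) e : linearly_independent v ->
  exists w : 'I_n -> H, [/\ linearly_independent w,
    forall V, linear_subspace V -> (forall i, V (v i)) -> forall i, V (w i)
    & forall i, dot (w i) e = 0].
Proof.
move=> iv.
(* If no pivot exists, any index will do: the quotients [b i] are then 0 / 0 = 0. *)
have [j hj] : exists j, dot (v j) e = 0 -> forall i, dot (v i) e = 0.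
  have [all0|/existsNP[j hj]] := pselect (forall i, dot (v i) e = 0).
    by exists ord0.
  by exists j.
pose b i := dot (v (lift j i)) e / dot (v j) e.
exists (fun i => v (lift j i) - b i *: v j); split.
- move=> c c0.
  pose c' i := if unlift j i is Some k then c k else - \sum_k c k * b k.
  have := iv c' _; rewrite (bigD1_ord j)//= /c' unlift_none.
  under eq_bigr do rewrite liftK.
  have -> : - (\sum_k c k * b k) *: v j + \sum_i c i *: v (lift j i) = 0.
    apply: etrans c0; rewrite scaleNr scaler_suml [LHS]addrC -sumrB; apply: eq_bigr => i _.
    by rewrite scalerBr scalerA.
  by move=> /(_ erefl) h i; have := h (lift j i); rewrite liftK.
- move=> V [V0 VD] Vv i.
  by rewrite addrC -scaleNr; apply: VD.
- move=> i; rewrite dotBl dotZl /b.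
  have [vj0|vj0] := eqVneq (dot (v j) e) 0; last by rewrite mulfVK// subrr.
  by rewrite !(hj vj0) mulr0 subrr.
Qed.

(** The set on the left is the orthogonal sum of [V] and the line of [e]. Projecting along [e] costs
    one vector of an independent family, and conversely [e] can be added to any independent family
    in [V]. *)
Lemma vdim_adjoin V e : linear_subspace V -> `|e| = 1 ->
  (forall v, V v -> dot v e = 0) ->
  vdim [set v | V (v - dot v e *: e)] = (vdim V + 1)%E.
Proof.
move=> sV e1 Ve; set W := [set v | _].
have ee : dot e e = 1 by exact: dot_unit.
have sW : linear_subspace W.
  case: sV => V0 VD; split; first by rewrite /W/= dot0l scale0r subr0.
  move=> a u v Wu Wv; rewrite /W/=.
  have -> : a *: u + v - dot (a *: u + v) e *: e =
     a *: (u - dot u e *: e) + (v - dot v e *: e).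
    rewrite dotDl dotZl scalerDl scalerBr scalerA opprD.
    by rewrite addrACA.
  exact: VD.
apply/eqP; rewrite eq_le; apply/andP; split.
  apply: vdim_le => -[|n] v Wv iv.
    by rewrite adde_ge0 ?vdim_ge0.
  have [w [iw sw we]] := independent_project e iv.
  rewrite -[n.+1%:R]natr1 EFinD leeD2r//.
  apply: le_vdim iw => i; have := sw _ sW Wv i.
  by rewrite /W/= we scale0r subr0.
rewrite -leeBrDr//; apply: vdim_le => n v Vv iv.
rewrite leeBrDr// -EFinD natr1.
pose w (i : 'I_n.+1) := if unlift ord0 i is Some k then v k else e.
apply: (@le_vdim W n.+1 w) => [i|c].
  rewrite /w; case: unlift => [k|] /=.
    by rewrite /W/= Ve// scale0r subr0.
  by rewrite /W/= ee scale1r subrr; case: sV.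
rewrite big_ord_recl /w unlift_none.
under eq_bigr do rewrite liftK.
move=> c0.
have c00 : c ord0 = 0.
  have := congr1 (fun x => dot x e) c0.
  rewrite dotDl dotZl ee mulr1 dot0l dot_suml big1 ?addr0// => i _.
  by rewrite dotZl Ve// mulr0.
move: c0; rewrite c00 scale0r add0r => /iv ci i.
by case: (unliftP ord0 i) => [k ->|->].
Qed.

End dimension.

(** * Adding orthogonal rank one blocks to an operator *)

Section rank_one_perturbation.
Context {R : realType} {H : hilbertType R}.
Local Notation C := (Cplx R).
Implicit Types (u v w x y e f : H) (a : C) (A : H -> H).

Definition rank1 e f (v : H) : H := dot v e *: f.

Lemma linear_rank1 e f : linear (rank1 e f).
Proof. by move=> a u v; rewrite /rank1 dotPl scalerDl scalerA. Qed.

Lemma linear_subspace_eigenspace_gram A r : linear A -> linear_subspace (eigenspace_gram A r).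
Proof.
move=> lA; split=> [x|a u v Au Av x]; first by rewrite linear_at0// !dot0r mulr0.
by rewrite lA !dotDr !dotZr Au Av; ring.
Qed.

(** The [p]-th power of the Schatten norm, which is additive over orthogonal blocks even when
    infinite. *)
Definition schatten_sum (p : R) A : \bar R :=
  \esum_(r in [set r : R | 0 < r]) (singular_multiplicity A r * (r `^ p)%:E)%E.

Lemma schatten_normE p A :
  schatten_norm p A = (schatten_sum p A `^ p^-1)%E.
Proof. by []. Qed.

Lemma schatten_sum_ge0 p A : (0 <= schatten_sum p A)%E.
Proof.
apply: esum_ge0 => r _; apply: mule_ge0; first exact: vdim_ge0.
by rewrite lee_fin powR_ge0.
Qed.

(** The orthogonality hypotheses remove the cross terms, so the Gram form of the sum is that of [A]
    plus c^2 on the line of [e]. The eigenspace for [c] gains [e], and those for other r > 0 do not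
    change. *)
Lemma singular_multiplicity_rank1 A e f (c r : R) : linear A ->
  `|e| = 1 -> `|f| = 1 -> A e = 0 -> (forall x, dot (A x) f = 0) ->
  0 < c -> 0 < r ->
  singular_multiplicity (fun v => A v + (c%:C)%C *: rank1 e f v) r =
  (singular_multiplicity A r + (r == c)%:R%:E)%E.
Proof.
move=> lA e1 f1 Ae Af c0 r0.
pose B v := A v + (c%:C)%C *: rank1 e f v.
have lB : linear B.
  move=> a u v; rewrite /B lA linear_rank1 !scalerDr !scalerA addrACA.
  by rewrite [_ * a]mulrC.
rewrite !singular_multiplicityE//.
have Af' x : dot f (A x) = 0 by exact/dot_sym0.
have cc : ((c%:C)%C : C)^* = (c%:C)%C.
  by apply/CrealP; rewrite ger0_real// ler0c ltW.
have BB x v : dot (B x) (B v) =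
   dot (A x) (A v) + ((c ^+ 2)%:C)%C * dot x e * dot e v.
  rewrite /B /rank1 !dotDl !dotDr !(dotZl, dotZr) Af Af' cc (dot_unit f1).
  rewrite -(dotC e v) rmorphXn/=; ring.
have ee := dot_unit e1.
have rN s : 0 < s -> ((s ^+ 2)%:C)%C != 0 :> C.
  by move=> s0; rewrite eq_complex/= eqxx andbT sqrf_eq0 gt_eqF.
have Ve s v : 0 < s -> eigenspace_gram A s v -> dot v e = 0.
  move=> s0 /(_ e); rewrite Ae dot0l => /esym/eqP.
  by rewrite mulf_eq0 (negbTE (rN s s0))/= => /eqP/dot_sym0.
have [->|rc] := eqVneq r c.
  rewrite -(@vdim_adjoin R H (eigenspace_gram A c) e)//; last 2 first.
  - exact: linear_subspace_eigenspace_gram.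
  - by move=> v; exact: Ve.
  congr vdim; apply/seteqP; split=> v /= h x.
    rewrite linear_atB// linear_atZ// Ae scaler0 subr0 dotBr dotZr -dotC mulrBr.
    by rewrite -h -/(B _) BB; ring.
  have := h x; rewrite linear_atB// linear_atZ// Ae scaler0 subr0 => Ax.
  by rewrite -!/(B _) BB Ax dotBr dotZr -dotC; ring.
rewrite adde0; congr vdim; apply/seteqP; split=> v /= h x.
  have ev : dot e v = 0.
    have := h e; rewrite -!/(B _) BB Ae dot0l ee add0r mulr1 => /eqP.
    rewrite -subr_eq0 -mulrBl mulf_eq0 => /orP[|/eqP//].
    rewrite subr_eq0 => /eqP/complexI/eqP.
    by rewrite eqrXn2 ?(ltW c0) ?(ltW r0)// eq_sym (negbTE rc).
  by rewrite -h -!/(B _) BB ev mulr0 addr0.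
by rewrite -!/(B _) BB (dot_sym0 (Ve _ _ r0 h)) mulr0 addr0 h.
Qed.

Lemma schatten_sum_rank1 p A e f (c : R) : linear A -> p != 0 ->
  `|e| = 1 -> `|f| = 1 -> A e = 0 -> (forall x, dot (A x) f = 0) -> 0 <= c ->
  schatten_sum p (fun v => A v + (c%:C)%C *: rank1 e f v) =
  (schatten_sum p A + (c `^ p)%:E)%E.
Proof.
move=> lA p0 e1 f1 Ae Af; rewrite le_eqVlt => /predU1P[<-|c0].
  rewrite powR0// adde0; congr schatten_sum; apply/funext => v.
  by rewrite scale0r addr0.
transitivity (\esum_(r in [set r : R | (0 < r)%R])
  (singular_multiplicity A r * (r `^ p)%:E + (r == c)%:R%:E * (r `^ p)%:E)%E).
  apply: eq_esum => r /= r0; rewrite singular_multiplicity_rank1//.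
  by rewrite ge0_muleDl ?vdim_ge0// lee_fin ler0n.
rewrite esumD; last 2 first.
- by move=> r _; rewrite mule_ge0 ?vdim_ge0// lee_fin powR_ge0.
- by move=> r _; rewrite mule_ge0 ?lee_fin ?powR_ge0 ?ler0n.
congr (_ + _)%E.
have -> : (c `^ p)%:E = \esum_(r in [set c]) (r `^ p)%:E.
  by rewrite esum_set1// lee_fin powR_ge0.
rewrite (_ : [set c] = [set r : R | 0 < r] `&` [set c]); last first.
  by apply/seteqP; split=> r /= => [->//|[]].
rewrite esum_mkcondr; apply: eq_esum => r _.
have [->|rc] := eqVneq r c; first by rewrite mem_set// mul1e.
by rewrite memNset ?mul0e// => /eqP; rewrite (negbTE rc).
Qed.

Lemma schatten_sum_rank1s p A N (e f : 'I_N -> H) (c : 'I_N -> R) :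
  linear A -> p != 0 ->
  (forall i j, dot (e i) (e j) = (i == j)%:R) ->
  (forall i j, dot (f i) (f j) = (i == j)%:R) ->
  (forall i, A (e i) = 0) -> (forall i x, dot (A x) (f i) = 0) ->
  (forall i, 0 <= c i) ->
  schatten_sum p (fun v => A v + \sum_i ((c i)%:C)%C *: rank1 (e i) (f i) v) =
  (schatten_sum p A + (\sum_i c i `^ p)%:E)%E.
Proof.
move=> lA p0 orthe orthf Ae Af c0.
have e1 := orthonormal_unit orthe.
have f1 := orthonormal_unit orthf.
have : uniq (index_enum 'I_N) by exact: index_enum_uniq.
elim: (index_enum 'I_N) => [_|i r ih /= /andP[ir ur]].
  rewrite big_nil adde0; congr schatten_sum; apply/funext => v.
  by rewrite big_nil addr0.
rewrite big_cons EFinD [((_)%:E + (_)%:E)%E]addeC addeA -ih//.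
rewrite -(@schatten_sum_rank1 p _ (e i) (f i)) ?e1 ?f1//.
- congr schatten_sum; apply/funext => v.
  by rewrite big_cons [X in _ + X]addrC addrA.
- move=> a u v; rewrite lA scalerDr scaler_sumr addrACA -big_split/=.
  congr (_ + _); apply: eq_bigr => j _.
  by rewrite linear_rank1 scalerDr scalerA [_ * a]mulrC -scalerA.
- rewrite Ae add0r big_seq big1// => j jr; rewrite /rank1 orthe.
  by rewrite (_ : (i == j) = false) ?scale0r ?scaler0//; apply: contraNF ir => /eqP ->.
- move=> x; rewrite dotDl Af add0r dot_suml big_seq big1// => j jr.
  rewrite /rank1 !dotZl orthf (_ : (j == i) = false) ?mulr0//.
  by apply: contraNF ir => /eqP <-.
Qed.

Lemma schatten_sum0 p : schatten_sum p (fun _ : H => 0) = 0%E.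
Proof.
rewrite /schatten_sum esum1// => r /= r0.
rewrite singular_multiplicityE//; last by move=> a u v; rewrite scaler0 addr0.
rewrite (_ : eigenspace_gram _ _ = [set 0]) ?vdim_set0 ?mul0e//.
apply/seteqP; split=> v /= => [h|-> x]; last by rewrite !dot0r mulr0.
apply: dot_eq0; have /esym/eqP := h v; rewrite dot0r mulf_eq0 => /orP[|/eqP//].
by rewrite eq_complex/= eqxx andbT sqrf_eq0 gt_eqF.
Qed.

End rank_one_perturbation.

(** * Gram-Schmidt orthonormalization of a sequence *)

Section gram_schmidt.
Context {R : realType} {H : hilbertType R}.
Local Notation C := (Cplx R).
Implicit Types (u v w x y e f : H).

(** It sends 0 to 0, so that vectors depending on earlier ones become zero vectors, which
    [hilbert_basis] allows. *)
Definition normalize u : H := `|u|^-1 *: u.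

Lemma normalize_unit u : normalize u = 0 \/ `|normalize u| = 1.
Proof.
have [->|u0] := eqVneq u 0; first by left; rewrite /normalize scaler0.
by right; rewrite normrZ normfV normr_id mulVf// normr_eq0.
Qed.

Lemma normalizeK u : `|u| *: normalize u = u.
Proof.
have [->|u0] := eqVneq u 0; first by rewrite /normalize !scaler0.
by rewrite scalerA mulfV ?scale1r// normr_eq0.
Qed.

Variable d : nat -> H.

Fixpoint gs_prefix n : seq H :=
  if n is k.+1 then
    let s := gs_prefix k in
    rcons s (normalize (d k - \sum_(e <- s) dot (d k) e *: e))
  else [::].

Definition gram_schmidt n := last 0 (gs_prefix n.+1).

Lemma gram_schmidtE n : gram_schmidt n =
  normalize (d n - \sum_(k < n) dot (d n) (gram_schmidt k) *: gram_schmidt k).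
Proof.
have gsE k : gs_prefix k = [seq gram_schmidt i | i <- iota 0 k].
  elim: k => [//|k ih]; rewrite -[in RHS]addn1 iotaD map_cat add0n cats1 -ih.
  by rewrite /gram_schmidt/= last_rcons.
rewrite /gram_schmidt/= last_rcons gsE big_map -(big_mkord xpredT
  (fun k => dot (d n) (gram_schmidt k) *: gram_schmidt k)).
by rewrite /index_iota subn0.
Qed.

Lemma gram_schmidt_unit n : gram_schmidt n = 0 \/ `|gram_schmidt n| = 1.
Proof. by rewrite gram_schmidtE; exact: normalize_unit. Qed.

Lemma gram_schmidt_orth_lt n k : (k < n)%N ->
  dot (gram_schmidt n) (gram_schmidt k) = 0.
Proof.
elim/ltn_ind: n k => n ih k kn.
rewrite [X in dot X _]gram_schmidtE /normalize dotZl.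
apply/eqP; rewrite mulf_eq0; apply/orP; right; apply/eqP.
rewrite dotBl dot_suml.
rewrite (bigD1 (Ordinal kn))//= big1 => [|j /= jk]; last first.
  rewrite dotZl; have [jk'|jk'|jk'] := ltngtP j k.
  - by rewrite (dot_sym0 (ih k kn j jk')) mulr0.
  - by rewrite ih// mulr0.
  - by move/eqP: jk; case; exact: val_inj.
rewrite dotZl addr0; have [->|/dot_unit ->] := gram_schmidt_unit k.
  by rewrite !dot0r mulr0 subr0.
by rewrite mulr1 subrr.
Qed.

Lemma gram_schmidt_orth i j : i != j ->
  dot (gram_schmidt i) (gram_schmidt j) = 0.
Proof.
case: ltngtP => // ij _; last exact: gram_schmidt_orth_lt.
by apply: dot_sym0; exact: gram_schmidt_orth_lt.
Qed.

Lemma gram_schmidt_complete v :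
  (forall n, dot v (gram_schmidt n) = 0) -> forall n, dot v (d n) = 0.
Proof.
move=> h n; have := h n; rewrite gram_schmidtE.
set s := \sum_(k < n) _ => hn.
have vs : dot v s = 0.
  by rewrite dot_sumr big1// => k _; rewrite dotZr h mulr0.
rewrite -[d n](subrK s) dotDr vs addr0 -[_ - s]normalizeK dotZr hn mulr0//.
Qed.

End gram_schmidt.

Section hilbert_basis.
Context {R : realType} {H : hilbertType R}.
Local Notation C := (Cplx R).

(** [trace] is characterized by a condition on all bases; it says something about its value only
    once a basis exists. *)
Lemma separable_hilbert_basis : separable_space (H := H) ->
  exists e : nat -> H, hilbert_basis e.
Proof.
move=> [D /countable_injP[f finj] Ddense].
pose d n := xget 0 [set x | D x /\ f x = n].
have dE x : D x -> d (f x) = x.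
  move=> Dx; apply: xget_unique => // y [Dy fxy].
  by apply: finj => //; rewrite inE.
exists (gram_schmidt d); split.
- exact: gram_schmidt_orth.
- exact: gram_schmidt_unit.
- move=> v /gram_schmidt_complete vd.
  apply/eqP; apply: contraT => v0.
  (* A point of [D] closer to [v] than 0 is cannot be orthogonal to [v], by Pythagoras. *)
  have [|x [/= xv Dx]] := Ddense (ball v `|v|) _ (ball_open _ _).
    by exists v; apply: ballxx; rewrite normr_gt0.
  have vx : dot v x = 0 by rewrite -(dE x Dx) vd.
  move: xv; rewrite -ball_normE /= => xv.
  have : `|v - x| ^+ 2 < `|v| ^+ 2 by rewrite ltr_sqr ?nnegrE.
  rewrite -!dotE dotBl !dotBr vx (dot_sym0 vx) subr0 sub0r opprK.
  by rewrite gtrDl => /(le_lt_trans (dot_ge0 x)); rewrite ltxx.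
Qed.

(** As [V] inverts [adjoint V], the latter is nonzero at every y nonzero, hence is not the default
    value there. *)
Lemma adjoint_spec_unitary (V : H -> H) : unitary V ->
  forall x y, dot (V x) y = dot x (adjoint V y).
Proof.
move=> [[lV _] VV VV'] x y.
have [->|y0] := eqVneq y 0.
  rewrite dot0r (_ : adjoint V 0 = 0) ?dot0r//.
  by apply: adjoint_spec => z; rewrite !dot0r.
apply: adjoint_neq0; apply: contraNneq y0 => h.
by have := VV' y; rewrite /= h linear_at0// => <-.
Qed.

(** The terms of the trace series have modulus |<V e, b_k>| |<f, b_k>|. The arithmetic-geometric
    mean inequality and Bessel's inequality for the unit vectors V e and f bound every partial sum
    by 1. The default value 0 of [trace] obeys the bound too. *)
Lemma norm_trace_rank1 (V : H -> H) e f : separable_space (H := H) ->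
  unitary V -> `|e| = 1 -> `|f| = 1 ->
  `|trace (rank1 e f \o adjoint V)| <= 1.
Proof.
move=> sepH uV e1 f1; have [b bP] := separable_hilbert_basis sepH.
rewrite /trace; case: xgetP => [c _ /(_ b bP) cvg_c|_]; last by rewrite normr0.
have Vspec := adjoint_spec_unitary uV.
have Ve1 : `|V e| = 1.
  have : `|V e| ^+ 2 = 1.
    rewrite -dotE Vspec; case: uV => _ VV _.
    by have := VV e; rewrite /= => ->; rewrite dot_unit.
  move=> /eqP; rewrite sqrf_eq1 => /orP[/eqP//|/eqP h].
  by have := normr_ge0 (V e); rewrite h oppr_ge0 ler10.
have sn n : `|series (fun k => dot ((rank1 e f \o adjoint V) (b k)) (b k)) n| <= 1.
  rewrite /series/=; apply: le_trans (ler_norm_sum _ _ _) _.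
  have [orth unit _] := bP.
  have unit' i : `|b i| = 1 \/ b i = 0 by case: (unit i); [right|left].
  have B1 := bessel_seq (V e) (iota_uniq 0 n) orth unit'.
  have B2 := bessel_seq f (iota_uniq 0 n) orth unit'.
  rewrite Ve1 expr1n in B1; rewrite f1 expr1n in B2.
  apply: (@le_trans _ _ (\sum_(k <- iota 0 n)
     (`|dot (V e) (b k)| ^+ 2 + `|dot f (b k)| ^+ 2) / 2)).
    rewrite /index_iota subn0; apply: ler_sum => k _.
    rewrite /rank1 dotZl normrM (dotC (adjoint V _)) -Vspec norm_conjC.
    rewrite ler_pdivlMr// -subr_ge0.
    set p := `|_|; set q := `|_|.
    rewrite (_ : _ - _ = (p - q) ^+ 2); last by ring.
    by rewrite real_exprn_even_ge0// rpredB ?normr_real.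
  rewrite -mulr_suml big_split/= ler_pdivrMr// mul1r.
  by rewrite (_ : 2 = 1 + 1)// lerD.
rewrite real_leNgt ?normr_real// ?real1//; apply/negP => c1.
have c10 : 0 < `|c| - 1 by rewrite subr_gt0.
have /cvgrPdist_lt/(_ _ c10)[n _ /(_ n (leqnn n))/= h] := cvg_c.
have h2 : `|c| <= `|c - series (fun k => dot ((rank1 e f \o adjoint V) (b k)) (b k)) n| + 1.
  apply: le_trans (lerD (lexx _) (sn n)).
  by rewrite -{1}[c](subrK
    (series (fun k => dot ((rank1 e f \o adjoint V) (b k)) (b k)) n)) ler_normD.
have h3 : `|c| < `|c| - 1 + 1 by apply: le_lt_trans h2 _; rewrite ltrD2r.
by rewrite subrK ltxx in h3.
Qed.

End hilbert_basis.

(** * Reduction to finite orthonormal systems of eigenvectors *)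

Section orthonormal_reduction.
Context {R : realType} {H : hilbertType R}.
Local Notation C := (Cplx R).
Implicit Types (u v w x y e f : H) (V W : set H).

(** A unit vector of [V] is split off and the rest is projected to its orthogonal complement. The
    result is a list because lists for different eigenvalues are later concatenated. *)
Lemma orthonormal_of_independent n (v : 'I_n -> H) V : linear_subspace V ->
  (forall i, V (v i)) -> linearly_independent v ->
  exists s : seq H, [/\ size s = n, {in s, forall x, V x /\ `|x| = 1}
    & pairwise (fun x y => dot x y == 0) s].
Proof.
elim: n v V => [|n ih] v V sV Vv iv; first by exists [::].
have [V0 VD] := sV.
have v0 : v ord0 != 0.
  apply/negP => /eqP v0.
  have := iv (fun i => (i == ord0)%:R) _ ord0.
  rewrite eqxx (bigD1 ord0)//= v0 scaler0 add0r big1 => [/(_ erefl)/eqP|i].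
    by rewrite oner_eq0.
  by move=> /negbTE ->; rewrite scale0r.
pose e : H := `|v ord0|^-1 *: v ord0.
have e1 : `|e| = 1 by rewrite normrZ normfV normr_id mulVf// normr_eq0.
have Ve : V e by rewrite -[e]addr0; exact: VD.
have [w [iw sw we]] := independent_project e iv.
have sV' : linear_subspace [set x | V x /\ dot x e = 0].
  split; first by split => //; exact: dot0l.
  move=> a x y [Vx xe] [Vy ye]; split; first exact: VD.
  by rewrite dotPl xe ye mulr0 addr0.
have [|s [sn sin sp]] := ih w _ sV' _ iw.
  by move=> i; split; [exact: (sw V)|exact: we].
exists (e :: s); split; first by rewrite /= sn.
- move=> x; rewrite inE => /predU1P[->//|/sin[[Vx _] x1]]; by split.
- rewrite /= sp andbT; apply/allP => x /sin[[_ xe] _].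
  by rewrite (dot_sym0 xe).
Qed.

Lemma eigenspace_gram_orth (T : H -> H) (r s : R) u v : 0 < r -> 0 < s ->
  r != s -> eigenspace_gram T r u -> eigenspace_gram T s v -> dot u v = 0.
Proof.
move=> r0 s0 rs Tu Tv.
have h1 := Tv u; have h2 := Tu v.
have h3 : dot (T u) (T v) = ((r ^+ 2)%:C)%C * dot u v.
  rewrite dotC h2 rmorphM/= -dotC; congr (_ * _).
  by apply/CrealP; rewrite ger0_real// ler0c sqr_ge0.
move: h1; rewrite h3 => /eqP; rewrite -subr_eq0 -mulrBl mulf_eq0.
move=> /orP[|/eqP//]; rewrite subr_eq0 => /eqP/complexI/eqP.
by rewrite eqrXn2 ?ltW// (negbTE rs).
Qed.

Lemma schatten_sum_le (T : H -> H) (q B : R) : linear T ->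
  (forall N (e : 'I_N -> H) (r : 'I_N -> R),
    (forall i j, dot (e i) (e j) = (i == j)%:R) -> (forall i, 0 < r i) ->
    (forall i, eigenspace_gram T (r i) (e i)) -> \sum_i r i `^ q <= B) ->
  (schatten_sum q T <= B%:E)%E.
Proof.
move=> lT bound.
pose system (s : seq (R * H)) :=
  {in s, forall p, [/\ 0 < p.1, `|p.2| = 1 & eigenspace_gram T p.1 p.2]} /\
  pairwise (fun p p' => dot p.2 p'.2 == 0) s.
have bound_seq s : system s -> \sum_(p <- s) p.1 `^ q <= B.
  move=> [sP sO]; pose x0 : R * H := (0, 0).
  rewrite (big_nth x0) big_mkord.
  apply: (bound (size s) (fun i => (nth x0 s i).2)) => [i j|i|i].
  - have [->|ij] := eqVneq i j.
      by apply: dot_unit; have [] := sP _ (mem_nth x0 (ltn_ord j)).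
    have : forall k l : 'I_(size s), (k < l)%N ->
        dot (nth x0 s k).2 (nth x0 s l).2 = 0.
      move=> k l kl; apply/eqP; move/(pairwiseP x0): sO; apply => //.
      - by rewrite inE.
      - by rewrite inE.
    move=> h; case: (ltngtP i j) => [/h//|/h/dot_sym0//|/val_inj ij'].
    by rewrite ij' eqxx in ij.
  - by have [] := sP _ (mem_nth x0 (ltn_ord i)).
  - by have [] := sP _ (mem_nth x0 (ltn_ord i)).
(* Induction on the values [l] not yet treated; [s] collects the eigenvectors already chosen for the
   others. *)
have key (l : seq R) (s : seq (R * H)) : uniq l -> {in l, forall r, 0 < r} ->
    system s -> {in s, forall p, p.1 \notin l} ->
    (\sum_(r <- l) (singular_multiplicity T r * (r `^ q)%:E)
       + (\sum_(p <- s) p.1 `^ q)%:E <= B%:E)%E.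
  elim: l s => [|r l ih] s; first by rewrite big_nil add0e lee_fin => _ _ ? _; exact: bound_seq.
  move=> /= /andP[rl ul] lpos [sP sO] sl.
  have r0 : 0 < r by apply: lpos; rewrite mem_head.
  have lpos' : {in l, forall r, 0 < r}.
    by move=> t tl; apply: lpos; rewrite inE tl orbT.
  rewrite big_cons singular_multiplicityE//.
  set X := (\sum_(t <- l) _)%E; set S := \sum_(p <- s) _.
  have X0 : (0 <= X)%E.
    by apply: sume_ge0 => t; rewrite mule_ge0 ?vdim_ge0// lee_fin powR_ge0.
  have step n (v : 'I_n -> H) : (forall i, eigenspace_gram T r (v i)) ->
      linearly_independent v -> (X + (n%:R * r `^ q + S)%:E <= B%:E)%E.
    move=> Ev iv.
    have [s' [ss' s'P s'O]] :=
      orthonormal_of_independent (linear_subspace_eigenspace_gram r lT) Ev iv.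
    have := ih ([seq (r, x) | x <- s'] ++ s) ul lpos' _ _.
    rewrite big_cat big_map/= big_const_seq count_predT ss' iter_addr_0 mulr_natl.
    apply.
      split=> [p|].
        rewrite mem_cat => /orP[/mapP[x /s'P[Ex x1] ->]//|/sP//].
      rewrite pairwise_cat sO andbT pairwise_map; apply/andP; split.
        apply/allrelP => _ p /mapP[x /s'P[Ex x1] ->] ps /=.
        have [p0 p1 Ep] := sP _ ps.
        apply/eqP; apply: (eigenspace_gram_orth r0 p0 _ Ex Ep).
        by have := sl _ ps; rewrite inE negb_or eq_sym => /andP[].
      exact: s'O.
    move=> p; rewrite mem_cat => /orP[/mapP[x _ ->]//|/sl].
    by rewrite inE negb_or => /andP[].
  (* Choosing no vector for [r] shows that [X] is finite. The bound on [n] can then be solved for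
     [n] and passes to the supremum [vdim]. *)
  have Xfin : X \is a fin_num.
    have v0 : 'I_0 -> H by case.
    have : (X + (0%:R * r `^ q + S)%:E <= B%:E)%E.
      by apply: (step 0 v0) => [[]//|c _ []].
    rewrite mul0r add0r => h; rewrite ge0_fin_numE//.
    rewrite ltey; apply: contraTneq h => ->.
    by rewrite addye// leye_eq.
  move: step; rewrite -(fineK Xfin); set x := fine X => step.
  have rq : 0 < r `^ q by exact: powR_gt0.
  have vle : (vdim (eigenspace_gram T r) <= ((B - x - S) / r `^ q)%:E)%E.
    apply: vdim_le => n v Ev iv; rewrite lee_fin ler_pdivlMr//.
    by have := step n v Ev iv; rewrite -EFinD lee_fin; lra.
  apply: (@le_trans _ _ ((B - x - S) / r `^ q * r `^ q + x + S)%:E).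
    rewrite !EFinD EFinM; apply: leeD => //; apply: leeD => //.
    by apply: lee_wpmul2r => //; rewrite lee_fin ltW.
  by rewrite lee_fin mulfVK ?gt_eqF//; lra.
rewrite /schatten_sum /esum; apply: ge_ereal_sup => _ [A [finA AS] <-].
rewrite fsbig_finite//=.
have := key (finmap.enum_fset (fset_set A)) [::] (finmap.fset_uniq _) _ _ _.
rewrite big_nil adde0; apply => //.
- by move=> r; rewrite in_fset_set// inE => /AS.
Qed.

End orthonormal_reduction.

(** * Perturbations of an operator along finitely many singular vectors *)

Section singular_system.
Context {R : realType} {H : hilbertType R} {N : nat}.
Local Notation C := (Cplx R).
Variables (T : H -> H) (e : 'I_N -> H) (r : 'I_N -> R).
Hypothesis cT : compact_operator T.
Hypothesis orthe : forall i j, dot (e i) (e j) = (i == j)%:R.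
Hypothesis r_gt0 : forall i, 0 < r i.
Hypothesis eigen : forall i, eigenspace_gram T (r i) (e i).
Implicit Types (a : 'I_N -> R) (b : R).

Let lT : linear T. Proof. by case: cT. Qed.

Definition left_vector i : H := (((r i)^-1)%:C)%C *: T (e i).

Definition singular_rank1 i : H -> H := rank1 (e i) (left_vector i).

Let conj_real b : ((b%:C)%C : C)^* = (b%:C)%C.
Proof. by apply/CrealP/complex_realP; exists b. Qed.

Let rC i : ((r i)%:C)%C * (((r i)^-1)%:C)%C = 1 :> C.
Proof. by rewrite -rmorphM/= mulfV// gt_eqF. Qed.

Let T_e i : T (e i) = ((r i)%:C)%C *: left_vector i.
Proof. by rewrite /left_vector scalerA rC scale1r. Qed.

Lemma left_vector_orth i j : dot (left_vector i) (left_vector j) = (i == j)%:R.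
Proof.
rewrite /left_vector dotZl dotZr conj_real eigen orthe.
have [->|ij] := eqVneq i j; last by rewrite !mulr0.
rewrite mulr1 -!rmorphM/= expr2.
have -> : (r j)^-1 * ((r j)^-1 * (r j * r j)) = 1 :> R.
  by rewrite !mulKf ?mulVf// gt_eqF.
by [].
Qed.

(** Composed with [T], it yields every operator needed: b = 1 gives the deflation of [T] and its
    perturbations, and b = 0 a single rank one block. *)
Definition spectral_multiplier b a v : H :=
  (b%:C)%C *: v + \sum_i ((a i)%:C)%C *: (dot v (e i) *: e i).

Lemma linear_spectral_multiplier b a : linear (spectral_multiplier b a).
Proof.
move=> k u v; rewrite /spectral_multiplier !scalerDr !scalerA [_ * k]mulrC.
rewrite [RHS]addrACA; congr (_ + _).
rewrite scaler_sumr -big_split/=; apply: eq_bigr => i _.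
rewrite dotPl scalerDl scalerDr !scalerA; congr (_ *: _ + _).
by rewrite mulrCA mulrA.
Qed.

Lemma compact_spectral_multiplier b a :
  compact_operator (T \o spectral_multiplier b a).
Proof.
apply: (compact_operator_comp (K := `|(b%:C)%C : C| + \sum_i `|((a i)%:C)%C : C|)) => //.
  exact: linear_spectral_multiplier.
move=> v; apply: le_trans (ler_normD _ _) _; rewrite mulrDl normrZ lerD2l.
apply: le_trans (ler_norm_sum _ _ _) _; rewrite mulr_suml; apply: ler_sum => i _.
have e1 := orthonormal_unit orthe i.
by rewrite !normrZ e1 mulr1 ler_wpM2l// norm_dot_unit.
Qed.

Lemma spectral_multiplierE b a v : T (spectral_multiplier b a v) =
  (b%:C)%C *: T v + \sum_i ((a i * r i)%:C)%C *: singular_rank1 i v.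
Proof.
rewrite /spectral_multiplier (linear_atD _ _ lT) (linear_atZ _ _ lT).
rewrite (linear_at_sum _ _ lT); congr (_ + _).
apply: eq_bigr => i _; rewrite (linear_atZ _ _ lT) (linear_atZ _ _ lT) T_e.
rewrite /singular_rank1 /rank1 !scalerA.
by congr (_ *: _); rewrite rmorphM/=; ring.
Qed.

Definition deflation : H -> H := T \o spectral_multiplier 1 (fun=> -1).

Lemma deflationE v :
  deflation v = T v - \sum_i ((r i)%:C)%C *: singular_rank1 i v.
Proof.
rewrite /deflation/= spectral_multiplierE scale1r -sumrN; congr (_ + _).
by apply: eq_bigr => i _; rewrite mulN1r rmorphN scaleNr.
Qed.

Lemma deflation_e i : deflation (e i) = 0.
Proof.
rewrite deflationE (bigD1 i)//= big1 => [|j ji].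
  by rewrite addr0 /singular_rank1 /rank1 orthe eqxx scale1r -T_e subrr.
by rewrite /singular_rank1 /rank1 orthe eq_sym (negbTE ji) scale0r scaler0.
Qed.

Lemma deflation_orth i x : dot (deflation x) (left_vector i) = 0.
Proof.
rewrite deflationE dotBl dot_suml (bigD1 i)//= big1 => [|j ji].
  rewrite addr0 /singular_rank1 /rank1 2!dotZl left_vector_orth eqxx mulr1.
  rewrite /left_vector dotZr conj_real eigen rmorphXn/=.
  have := rC i; set ri := ((r i)%:C)%C; set ri' := (((r i)^-1)%:C)%C => rr'.
  rewrite [ri' * _](_ : _ = ri * ri' * (ri * dot x (e i))); last by ring.
  by rewrite rr' mul1r subrr.
by rewrite /singular_rank1 /rank1 2!dotZl left_vector_orth (negbTE ji) !mulr0.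
Qed.

Lemma schatten_sum_deflation (p : R) a : p != 0 -> (forall i, 0 <= a i) ->
  schatten_sum p (fun v => deflation v + \sum_i ((a i)%:C)%C *: singular_rank1 i v) =
  (schatten_sum p deflation + (\sum_i a i `^ p)%:E)%E.
Proof.
move=> p0 a0; apply: schatten_sum_rank1s => //.
- by case: (compact_spectral_multiplier 1 (fun=> -1)).
- exact: left_vector_orth.
- exact: deflation_e.
- exact: deflation_orth.
Qed.

(** Both sides are the sum for [deflation] plus finitely many squares, of r_i + a_i on the left and
    of r_i inside the sum for [T]. Nothing is subtracted, so infinite values are harmless. *)
Lemma schatten_sum_add_rank1s a : (forall i, 0 <= a i) ->
  schatten_sum 2 (fun v => T v + \sum_i ((a i)%:C)%C *: singular_rank1 i v) =
  (schatten_sum 2 T + (\sum_i (2 * r i * a i + a i ^+ 2))%:E)%E.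
Proof.
move=> a0.
have TE v : T v = deflation v + \sum_i ((r i)%:C)%C *: singular_rank1 i v.
  by rewrite deflationE subrK.
have -> : schatten_sum 2 T =
    (schatten_sum 2 deflation + (\sum_i r i `^ 2)%:E)%E.
  rewrite -schatten_sum_deflation//; last by move=> i; exact: ltW.
  by congr schatten_sum; apply/funext.
rewrite -addeA -EFinD -big_split/=.
have -> : \sum_i (r i `^ 2 + (2 * r i * a i + a i ^+ 2)) = \sum_i (r i + a i) `^ 2.
  apply: eq_bigr => i _; rewrite !powR_mulrn ?addr_ge0 ?(ltW (r_gt0 i))//.
  by ring.
rewrite -schatten_sum_deflation//; last by move=> i; rewrite addr_ge0// ltW.
congr schatten_sum; apply/funext => v; rewrite TE -addrA -big_split/=.
by congr (_ + _); apply: eq_bigr => i _; rewrite rmorphD/= scalerDl.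
Qed.

Lemma compact_add_rank1s a :
  compact_operator (fun v => T v + \sum_i ((a i)%:C)%C *: singular_rank1 i v).
Proof.
have := compact_spectral_multiplier 1 (fun i => a i / r i).
congr compact_operator; apply/funext => v /=.
rewrite spectral_multiplierE scale1r; congr (_ + _).
by apply: eq_bigr => i _; rewrite mulfVK// gt_eqF.
Qed.

Lemma compact_singular_rank1 i : compact_operator (singular_rank1 i).
Proof.
have := compact_spectral_multiplier 0 (fun j => (j == i)%:R / r i).
congr compact_operator; apply/funext => v /=.
rewrite spectral_multiplierE scale0r add0r (bigD1 i)//= big1 => [|j ji].
  by rewrite eqxx mul1r mulVf ?gt_eqF// scale1r addr0.
by rewrite (negbTE ji) !mul0r scale0r.
Qed.

Lemma schatten_sum_singular_rank1 (p : R) i : p != 0 ->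
  schatten_sum p (singular_rank1 i) = 1%E.
Proof.
move=> p0.
have := @schatten_sum_rank1 R H p (fun=> 0) (e i) (left_vector i) 1.
rewrite schatten_sum0 add0e powR1 => <- //.
- by congr schatten_sum; apply/funext => v; rewrite add0r scale1r.
- by move=> k u v; rewrite scaler0 addr0.
- exact: orthonormal_unit.
- by apply: orthonormal_unit; exact: left_vector_orth.
- by move=> x; rewrite dot0l.
Qed.

End singular_system.

(** * Fourier transforms of the singular vectors *)

Section complex_valued_functions.
Context {d : measure_display} {T : measurableType d} {R : realType}.
Variable mu : {measure set T -> \bar R}.
Implicit Types (g h : T -> Cplx R) (u v : T -> R).

Lemma rnormE (z : Cplx R) : rnorm z = modulus (complex.Re (z : R[i])) (complex.Im (z : R[i])).
Proof. by rewrite /rnorm normc_def. Qed.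

Definition reF g x : R := complex.Re (g x : R[i]).
Definition imF g x : R := complex.Im (g x : R[i]).

Lemma ip_ae u v u' v' : measurable_fun setT u -> measurable_fun setT v ->
  measurable_fun setT u' -> measurable_fun setT v' ->
  {ae mu, forall x, u x = u' x} -> {ae mu, forall x, v x = v' x} ->
  ip mu u v = ip mu u' v'.
Proof.
move=> m1 m2 m1' m2' uu vv; congr fine; apply: ae_eq_integral => //.
- by apply/measurable_EFinP; exact: measurable_funM.
- by apply/measurable_EFinP; exact: measurable_funM.
- by apply: filterS2 uu vv => x -> -> _.
Qed.

Lemma in_cLp2 g : in_cLp mu 2 g ->
  [/\ sqint mu (reF g), sqint mu (imF g) &
   (Lnorm mu 2%:E (fun x => (rnorm (g x))%:E) `^ 2)%E =
   (ip mu (reF g) (reF g) + ip mu (imF g) (imF g))%:E].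
Proof.
move=> [mre mim fin].
have mm : measurable_fun setT (fun x => modulus (reF g x) (imF g x)).
  exact: measurable_modulus.
have iE : (Lnorm mu 2%:E (fun x => (rnorm (g x))%:E) `^ 2)%E =
    (\int[mu]_x (reF g x ^+ 2 + imF g x ^+ 2)%:E)%E.
  rewrite poweR_Lnorm//; apply: eq_integral => x _ /=.
  rewrite rnormE ger0_norm ?modulus_ge0// powR_mulrn ?modulus_ge0//.
  by rewrite sqr_modulus.
have isum : integrableR mu (fun x => reF g x ^+ 2 + imF g x ^+ 2).
  apply/integrableRE; split.
    by apply: measurable_funD; exact: measurable_funX.
  under eq_integral => x _ do rewrite gee0_abs ?lee_fin ?addr_ge0 ?sqr_ge0//.
  by rewrite -iE poweR_lty.
have sre : sqint mu (reF g).
  split => //; apply: le_integrableR isum; first exact: measurable_funX.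
  by move=> x; rewrite ger0_norm ?sqr_ge0// lerDl sqr_ge0.
have sim : sqint mu (imF g).
  split => //; apply: le_integrableR isum; first exact: measurable_funX.
  by move=> x; rewrite ger0_norm ?sqr_ge0// lerDr sqr_ge0.
split => //; rewrite iE -RintegralD//; [|exact: sqintM|exact: sqintM].
rewrite fineK; last exact: (integrable_fin_num (f := fun x => (_ x)%:E) _ isum).
by [].
Qed.

Lemma Lnorm_EFin_powR (r : R) u : (forall x, 0 <= u x) ->
  Lnorm mu r%:E (EFin \o u) = ((\int[mu]_x (u x `^ r)%:E) `^ r^-1)%E.
Proof.
move=> u0; rewrite unlock /Lnorm.
by under eq_integral => x _ do rewrite /= ger0_norm//.
Qed.

End complex_valued_functions.

(** * Hoelder's inequality with the Sobolev weight *)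

Section weighted_hoelder.
Context {d : measure_display} {T : measurableType d} {R : realType}.
Variable mu : {measure set T -> \bar R}.
Variables (s alpha : R) (gamma m : T -> R).
Hypothesis s_gt0 : 0 < s.
Hypothesis s_lt_alpha : s < alpha.
Hypothesis gamma_meas : measurable_fun setT gamma.
Hypothesis m_meas : measurable_fun setT m.
Hypothesis m_ge0 : forall x, 0 <= m x.

Let p := 2 * alpha / (alpha + s).
Let w x := 1 / (1 + gamma x ^+ 2).

Let one_gamma_gt0 x : 0 < 1 + gamma x ^+ 2.
Proof. by rewrite ltr_pwDl// sqr_ge0. Qed.

(** The weight is split off as m^p = f g with f^(2/p) the Sobolev integrand and g = w^(sp/2). The
    value of [p] is the one for which the conjugate exponent 2/(2-p) turns g into w^alpha. *)
Lemma weighted_hoelder :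
  (Lnorm mu p%:E (EFin \o m) <=
   (\int[mu]_x ((1 + gamma x ^+ 2) `^ s * m x ^+ 2)%:E) `^ 2^-1 *
   Lnorm mu alpha%:E (EFin \o w) `^ (s / 2))%E.
Proof.
have [s0 sa] := (s_gt0, s_lt_alpha).
have as0 : 0 < alpha + s by lra.
have al0 : 0 < alpha by lra.
have p0 : 0 < p by rewrite divr_gt0// mulr_gt0.
have p2 : p < 2 by rewrite /p ltr_pdivrMr//; lra.
have wE x : w x = (1 + gamma x ^+ 2) `^ (- 1).
  by rewrite powR_inv1 ?(ltW (one_gamma_gt0 x))// /w div1r.
have w0 x : 0 <= w x by rewrite wE powR_ge0.
pose f x := ((1 + gamma x ^+ 2) `^ s * m x ^+ 2) `^ (p / 2).
pose g x := w x `^ (s * p / 2).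
have f0 x : 0 <= f x by exact: powR_ge0.
have g0 x : 0 <= g x by exact: powR_ge0.
have mg2 : measurable_fun setT (fun x => 1 + gamma x ^+ 2).
  by apply: measurable_funD => //; exact: measurable_funX.
have mw : measurable_fun setT w.
  rewrite (_ : w = (fun x => (1 + gamma x ^+ 2) `^ (- 1))); last exact/funext.
  exact: (measurableT_comp (measurable_powR _)).
have mf : measurable_fun setT f.
  apply: (measurableT_comp (measurable_powR _)).
  apply: measurable_funM; last exact: measurable_funX.
  exact: (measurableT_comp (measurable_powR _)).
have mg : measurable_fun setT g by exact: (measurableT_comp (measurable_powR _)).
have := @hoelder _ _ _ mu f g (2 / p) (2 / (2 - p)) mf mg.
have Nf : Lnorm mu (2 / p)%:E (EFin \o f) =
    ((\int[mu]_x ((1 + gamma x ^+ 2) `^ s * m x ^+ 2)%:E) `^ (2 / p)^-1)%E.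
  rewrite Lnorm_EFin_powR; last exact: f0.
  congr (_ `^ _)%E; apply: eq_integral => x _; rewrite /f -powRrM.
  rewrite (_ : p / 2 * (2 / p) = 1); last by field; nz.
  by rewrite powRr1// mulr_ge0 ?powR_ge0 ?sqr_ge0.
have Ng : Lnorm mu (2 / (2 - p))%:E (EFin \o g) =
    ((\int[mu]_x (w x `^ alpha)%:E) `^ (2 / (2 - p))^-1)%E.
  rewrite Lnorm_EFin_powR; last exact: g0.
  congr (_ `^ _)%E; apply: eq_integral => x _; rewrite /g -powRrM; congr (_ `^ _)%:E.
  rewrite /p; field.
  by rewrite !gt_eqF//; lra.
have Nfg : (\int[mu]_x `|(EFin \o (f \* g)%R) x| = \int[mu]_x (m x `^ p)%:E)%E.
  apply: eq_integral => x _ /=; rewrite ger0_norm ?mulr_ge0//; congr EFin.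
  rewrite /f /g wE powRM ?powR_ge0 ?sqr_ge0// -!powRrM.
  rewrite mulrAC -powRD; last first.
    by apply/implyP => _; rewrite gt_eqF.
  rewrite (_ : s * (p / 2) + -1 * (s * p / 2) = 0); last by ring.
  by rewrite powRr0 mul1r -powR_mulrn// -powRrM; congr powR; field.
rewrite Lnorm1 Nf Ng Nfg !Lnorm_EFin_powR//.
set I := integral _ _ _; set A := integral _ _ _; set B := integral _ _ _.
move=> h.
have {h} h : (I <= A `^ (p / 2) * B `^ ((2 - p) / 2))%E.
  rewrite -[p / 2]invf_div -[(2 - p) / 2]invf_div; apply: h.
  - by rewrite divr_gt0.
  - by rewrite divr_gt0//; lra.
  - by rewrite !invf_div; field.
have A0 : (0 <= A)%E.
  by apply: integral_ge0 => x _; rewrite lee_fin mulr_ge0 ?powR_ge0 ?sqr_ge0.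
have B0 : (0 <= B)%E by apply: integral_ge0 => x _; rewrite lee_fin powR_ge0.
have I0 : (0 <= I)%E by apply: integral_ge0 => x _; rewrite lee_fin powR_ge0.
apply: (@le_trans _ _ ((A `^ (p / 2) * B `^ ((2 - p) / 2)) `^ p^-1)%E).
  apply: gt0_ler_poweR => //; first by rewrite invr_ge0 ltW.
  - by rewrite in_itv/= I0 leey.
  - by rewrite in_itv/= mule_ge0 ?poweR_ge0// leey.
rewrite poweRM ?poweR_ge0// -!poweRrM.
rewrite (_ : p / 2 / p = 2^-1); last by field; nz.
rewrite (_ : (2 - p) / 2 / p = alpha^-1 * (s / 2))//.
rewrite /p; field.
by rewrite !gt_eqF//; lra.
Qed.

End weighted_hoelder.

(** * Plancherel's theorem as a real inner product on operators *)

Section fourier_inner_product.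
Context {R : realType} {G : topologicalZmodType} {H : hilbertType R}.
Variables (m : G -> G -> Cplx R) (U : G -> H -> H)
  (mu : {measure set (borel (dual_group R G)) -> \bar R})
  (F : (H -> H) -> borel (dual_group R G) -> Cplx R).
Hypothesis F_fourier : quantum_fourier m U mu F.
Implicit Types A B X : H -> H.

Lemma schattenE (p : R) A : p != 0 ->
  schatten p A <-> compact_operator A /\ (schatten_sum p A < +oo)%E.
Proof.
move=> p0; rewrite /schatten/= schatten_normE; split=> -[cA sA]; split=> //.
  by apply: lty_poweRy sA; rewrite invr_eq0.
exact: poweR_lty.
Qed.

Definition fip A B :=
  ip mu (reF (F A)) (reF (F B)) + ip mu (imF (F A)) (imF (F B)).

Lemma fourier_sqint A : schatten 2 A ->
  sqint mu (reF (F A)) /\ sqint mu (imF (F A)).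
Proof. by case: F_fourier => _ h _ _ _ /h/in_cLp2[]. Qed.

Lemma fip_norm A : schatten 2 A -> (fip A A)%:E = schatten_sum 2 A.
Proof.
case: F_fourier => _ h _ n _ sA; have [_ _ <-] := in_cLp2 (h A sA).
rewrite n// schatten_normE -poweRrM mulVf// poweRe1//.
exact: schatten_sum_ge0.
Qed.

Lemma fipC A B : fip A B = fip B A.
Proof. by rewrite /fip ipC [X in _ + X]ipC. Qed.

(** Membership of the sum is a hypothesis, to be discharged only where its singular values are
    known. *)
Lemma fip_add A B X : schatten 2 A -> schatten 2 B ->
  schatten 2 (fun v => A v + B v) -> schatten 2 X ->
  fip (fun v => A v + B v) X = fip A X + fip B X.
Proof.
move=> sA sB sAB sX.
have FAB : {ae mu, forall xi, F (fun v => A v + B v) xi = F A xi + F B xi}.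
  case: F_fourier => _ _ lin _ _; have := lin 1 A B sA sB.
  apply: filterS => xi; rewrite mul1r => <-; congr (F _ xi).
  by apply/funext => v; rewrite scale1r.
have [rA iA] := fourier_sqint sA; have [rB iB] := fourier_sqint sB.
have [rAB iAB] := fourier_sqint sAB; have [rX iX] := fourier_sqint sX.
rewrite /fip addrACA -!ipDl//; congr (_ + _); apply: ip_ae;
  try by [case: rAB|case: iAB|case: rX|case: iX|exact: (aeW mu)].
- by case: (sqintD rA rB).
- apply: filterS FAB => xi; rewrite /reF => ->.
  exact: (raddfD (@complex.Re R)).
- by case: (sqintD iA iB).
- apply: filterS FAB => xi; rewrite /imF => ->.
  exact: (raddfD (@complex.Im R)).
Qed.

Lemma fip_add_sqr A B : schatten 2 A -> schatten 2 B ->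
  schatten 2 (fun v => A v + B v) ->
  fip (fun v => A v + B v) (fun v => A v + B v) =
  fip A A + 2 * fip A B + fip B B.
Proof.
move=> sA sB sAB; rewrite fip_add//.
rewrite [fip A _]fipC [fip B _]fipC !fip_add// (fipC B A).
by ring.
Qed.

End fourier_inner_product.

(** * Fourier coefficients along the singular system *)

Section singular_values.
Context {R : realType} {G : topologicalZmodType} {H : hilbertType R}.
Variables (m : G -> G -> Cplx R) (U : G -> H -> H)
  (mu : {measure set (borel (dual_group R G)) -> \bar R})
  (F : (H -> H) -> borel (dual_group R G) -> Cplx R).
Hypothesis H_separable : separable_space (H := H).
Hypothesis U_representation : projective_representation m U.
Hypothesis F_fourier : quantum_fourier m U mu F.
Context {N : nat}.
Variables (T : H -> H) (e : 'I_N -> H) (r : 'I_N -> R).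
Hypothesis sT : schatten 2 T.
Hypothesis orthe : forall i j, dot (e i) (e j) = (i == j)%:R.
Hypothesis r_gt0 : forall i, 0 < r i.
Hypothesis eigen : forall i, eigenspace_gram T (r i) (e i).
Implicit Types a c : 'I_N -> R.

Let cT : compact_operator T. Proof. by case: sT. Qed.

Local Notation S := (singular_rank1 T e r).
Local Notation fip := (fip mu F).

Let two_neq0 : (2 : R) != 0. Proof. by rewrite pnatr_eq0. Qed.

Let sumT : schatten_sum 2 T = (fip T T)%:E.
Proof. by rewrite (fip_norm F_fourier). Qed.

Let schatten_add a : (forall i, 0 <= a i) ->
  schatten 2 (fun v => T v + \sum_i ((a i)%:C)%C *: S i v).
Proof.
move=> a0; apply/schattenE => //; split.
  exact: (compact_add_rank1s cT).
by rewrite (schatten_sum_add_rank1s cT)// sumT -EFinD ltry.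
Qed.

Let schatten_S (p : R) i : p != 0 -> schatten p (S i).
Proof.
move=> p0; apply/schattenE => //; split.
  exact: (compact_singular_rank1 cT).
by rewrite (schatten_sum_singular_rank1 orthe r_gt0 eigen)// ltry.
Qed.

Let S2 i : schatten 2 (S i). Proof. exact: schatten_S. Qed.

Let fipSS i : fip (S i) (S i) = 1.
Proof.
apply: EFin_inj; rewrite (fip_norm F_fourier); last exact: schatten_S.
by rewrite (schatten_sum_singular_rank1 orthe r_gt0 eigen).
Qed.

Let sum_delta i (X : 'I_N -> H) :
  \sum_j (((j == i)%:R : R)%:C)%C *: X j = X i.
Proof.
rewrite (bigD1 i)//= eqxx scale1r big1 ?addr0// => j /negbTE ->.
by rewrite scale0r.
Qed.

Let schatten_TS i : schatten 2 (fun v => T v + S i v).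
Proof.
have := @schatten_add (fun j => (j == i)%:R) (fun=> ler0n _ _).
by congr (schatten 2); apply/funext => v; rewrite sum_delta.
Qed.

(** Adding S_i to [T] raises the squared norm by 2 r_i + 1, while the expansion of the square gives
    2 <T, S_i> + 1. *)
Lemma fip_singular_value i : fip T (S i) = r i.
Proof.
have := schatten_sum_add_rank1s cT orthe r_gt0 eigen
  (a := fun j => (j == i)%:R) (fun=> ler0n _ _).
have -> : (fun v => T v + \sum_j (((j == i)%:R : R)%:C)%C *: S j v) =
          (fun v => T v + S i v).
  by apply/funext => v; rewrite sum_delta.
rewrite -(fip_norm F_fourier)// sumT -EFinD => /eqP; rewrite eqe => /eqP.
rewrite (fip_add_sqr F_fourier sT (S2 i) (schatten_TS i)).
rewrite fipSS (bigD1 i)//= eqxx big1 => [|j /negbTE ->]; last first.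
  by rewrite mulr0 expr0n addr0.
by rewrite mulr1 expr1n addr0; lra.
Qed.

(** For i and j distinct, the squared norm of T + S_i + S_j exceeds that of [T] by 2 r_i + 1 + 2 r_j
    + 1, which leaves no room for the cross term of S_i and S_j. *)
Lemma fip_orthonormal i j : fip (S i) (S j) = (i == j)%:R.
Proof.
have [->|ij] := eqVneq i j; first exact: fipSS.
pose a k : R := (k == i)%:R + (k == j)%:R.
have a0 k : 0 <= a k by rewrite addr_ge0// ler0n.
have aE : (fun v => T v + \sum_k ((a k)%:C)%C *: S k v) =
          (fun v => (T v + S i v) + S j v).
  apply/funext => v; rewrite -addrA; congr (_ + _).
  rewrite -(sum_delta i (fun k => S k v)) -(sum_delta j (fun k => S k v)).
  by rewrite -big_split/=; apply: eq_bigr => k _; rewrite rmorphD/= scalerDl.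
have sij := schatten_add a0; rewrite aE in sij.
have := schatten_sum_add_rank1s cT orthe r_gt0 eigen a0.
rewrite aE -(fip_norm F_fourier)// sumT -EFinD => /eqP; rewrite eqe => /eqP.
rewrite (fip_add_sqr F_fourier (schatten_TS i) (S2 j) sij).
rewrite (fip_add F_fourier sT (S2 i) (schatten_TS i) (S2 j)).
rewrite (fip_add_sqr F_fourier sT (S2 i) (schatten_TS i)).
rewrite !fipSS !fip_singular_value.
rewrite (bigD1 i)//= (bigD1 j)//=; last by rewrite eq_sym.
rewrite big1 => [|k /andP[/negbTE ki /negbTE kj]]; last first.
  by rewrite /a ki kj addr0 mulr0 expr0n addr0.
rewrite /a !eqxx (negbTE ij) eq_sym (negbTE ij) addr0 add0r !mulr1 expr1n.
by lra.
Qed.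

(* Radial truncation makes the bound |F (S i)| <= 1, known almost everywhere,
   hold at every point. *)
Let trunc (A : H -> H) xi : R := (Num.max 1 (rnorm (F A xi)))^-1.
Let u i xi : R := trunc (S i) xi * reF (F (S i)) xi.
Let v i xi : R := trunc (S i) xi * imF (F (S i)) xi.

Let trunc_ae i : {ae mu, forall xi, trunc (S i) xi = 1}.
Proof.
case: F_fourier => trF _ _ _ _.
have := trF _ (schatten_S i (oner_neq0 R)); apply: filterS => xi FE.
rewrite /trunc FE.
have : `|trace_fourier m U (S i) xi| <= 1.
  apply: norm_trace_rank1 => //.
  - by case: U_representation => uU _ _ _ _; exact: uU.
  - exact: orthonormal_unit.
  - by apply: orthonormal_unit; exact: (left_vector_orth orthe r_gt0 eigen).
rewrite lecE => /andP[_ h].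
by rewrite max_l ?invr1.
Qed.

Let trunc_meas i : measurable_fun setT (trunc (S i)).
Proof.
have [[mr _] [mi _]] := fourier_sqint F_fourier (S2 i).
rewrite (_ : trunc _ = (fun xi => (Num.max 1
   (modulus (reF (F (S i)) xi) (imF (F (S i)) xi))) `^ (- 1))).
  apply: (measurableT_comp (measurable_powR _)).
  apply: measurable_maxr => //; exact: measurable_modulus.
by apply/funext => xi; rewrite /trunc rnormE powR_inv1// le_max ler01.
Qed.

Let u_ae i : {ae mu, forall xi, u i xi = reF (F (S i)) xi}.
Proof. by apply: filterS (trunc_ae i) => xi h; rewrite /u h mul1r. Qed.

Let v_ae i : {ae mu, forall xi, v i xi = imF (F (S i)) xi}.
Proof. by apply: filterS (trunc_ae i) => xi h; rewrite /v h mul1r. Qed.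

Let trunc_bound A xi : 0 <= trunc A xi <= 1.
Proof.
rewrite invr_ge0 le_max ler01 /=.
by rewrite invf_le1 ?le_max ?lexx// lt_max ltr01.
Qed.

Let uM i : measurable_fun setT (u i).
Proof.
apply: measurable_funM; first exact: trunc_meas.
by have [[]] := fourier_sqint F_fourier (S2 i).
Qed.

Let vM i : measurable_fun setT (v i).
Proof.
apply: measurable_funM; first exact: trunc_meas.
by have [_ []] := fourier_sqint F_fourier (S2 i).
Qed.

Let trunc_sqint A f : measurable_fun setT (trunc A) ->
  sqint mu f -> sqint mu (fun xi => trunc A xi * f xi).
Proof.
move=> mt [mf iF]; have mtf : measurable_fun setT (fun xi => trunc A xi * f xi).
  exact: measurable_funM.
split => //; apply: le_integrableR iF; first exact: measurable_funX.
move=> xi; rewrite ger0_norm ?sqr_ge0// exprMn ler_piMl ?sqr_ge0//.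
by have /andP[t0 t1] := trunc_bound A xi; rewrite exprn_ile1.
Qed.

Let uv_orth : orthonormal_pair mu u v.
Proof.
have su i : sqint mu (u i).
  have [sr _] := fourier_sqint F_fourier (S2 i).
  exact: (trunc_sqint (trunc_meas i) sr).
have sv i : sqint mu (v i).
  have [_ si] := fourier_sqint F_fourier (S2 i).
  exact: (trunc_sqint (trunc_meas i) si).
split => // i j.
have [[mri _] [mii _]] := fourier_sqint F_fourier (S2 i).
have [[mrj _] [mij _]] := fourier_sqint F_fourier (S2 j).
rewrite -fip_orthonormal /fip.
rewrite (ip_ae (uM i) (uM j) mri mrj (u_ae i) (u_ae j)).
by rewrite (ip_ae (vM i) (vM j) mii mij (v_ae i) (v_ae j)).
Qed.

Let uv_bound i xi : modulus (u i xi) (v i xi) <= 1.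
Proof.
have /andP[t0 _] := trunc_bound (S i) xi.
rewrite /u /v modulusZ ger0_norm// -rnormE /trunc mulrC ler_pdivrMr.
  by rewrite mul1r le_max lexx orbT.
by rewrite lt_max ltr01.
Qed.

Lemma singular_values_le (q K : R) : 2 < q -> 0 <= K ->
  (Lnorm mu (q / (q - 1))%:E (fun xi => (rnorm (F T xi))%:E) <= K%:E)%E ->
  \sum_i r i `^ q <= K `^ q.
Proof.
move=> q2 K0 FK; set p := q / (q - 1) in FK.
have q1 : 0 < q - 1 by lra.
have q0 : 0 < q by lra.
have p0 : 0 < p by rewrite divr_gt0.
(* The extremal test sequence: it pairs with the coefficients r_i to [D], and its l^p sum is again
   [D]. Duality gives D <= D^(1-1/q) K, hence D^(1/q) <= K. *)
pose c i := r i `^ (q - 1).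
set D := \sum_i _.
have D0 : 0 <= D by apply: sumr_ge0 => i _; exact: powR_ge0.
have [sre sim] := fourier_sqint F_fourier sT.
have [su sv _] := uv_orth.
have slu : sqint mu (lc u c) by exact: sqint_sum.
have slv : sqint mu (lc v c) by exact: sqint_sum.
have pairE : pairing mu u v c (reF (F T)) (imF (F T)) = D.
  rewrite (pairing_sum uv_orth)//; apply: eq_bigr => i _.
  have [[mr _] [mi _]] := fourier_sqint F_fourier (S2 i).
  rewrite (ip_ae (uM i) sre.1 mr sre.1 (u_ae i) (aeW mu (fun=> erefl))).
  rewrite (ip_ae (vM i) sim.1 mi sim.1 (v_ae i) (aeW mu (fun=> erefl))).
  rewrite -/(fip (S i) T) fipC fip_singular_value /c mulrC mulr_powRB1//.
  exact: ltW.
have DleJ : (D%:E <= Lnorm mu q%:E (EFin \o lcmod u v c) *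
   Lnorm mu p%:E (fun xi => (rnorm (F T xi))%:E))%E.
  have mm : measurable_fun setT (fun xi => rnorm (F T xi)).
    under eq_fun do rewrite rnormE.
    by apply: measurable_modulus; [case: sre|case: sim].
  have ml : measurable_fun setT (lcmod u v c).
    by apply: measurable_modulus; [case: slu|case: slv].
  apply: le_trans (hoelder mu ml mm q0 p0 _); last first.
    by rewrite /p; field; apply/andP; split; apply: lt0r_neq0.
  rewrite Lnorm1 -pairE /pairing -RintegralD//; [|exact: sqintM|exact: sqintM].
  have isum : integrableR mu (fun x => lc u c x * reF (F T) x + lc v c x * imF (F T) x).
    by apply: integrableRD; exact: sqintM.
  rewrite fineK; last exact: (integrable_fin_num _ isum).
  apply: le_trans (lee_abs _) _.
  apply: le_trans (le_abse_integral _ _ _) _ => //.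
    by apply/measurable_EFinP; exact: integrableR_measurable isum.
  apply: ge0_le_integral => //.
  - apply: measurableT_comp => //; apply/measurable_EFinP.
    exact: integrableR_measurable isum.
  - apply: measurableT_comp => //; apply/measurable_EFinP.
    exact: measurable_funM.
  - move=> xi _ /=; rewrite lee_fin; apply: le_trans (modulus_dot _ _ _ _) _.
    by rewrite -rnormE ler_norm.
have lcE : (Lnorm mu q%:E (EFin \o lcmod u v c) <= (D `^ (1 - q^-1))%:E)%E.
  rewrite Lnorm_EFin_powR; last by move=> xi; exact: lcmod_ge0.
  have il := lcint_integrable uv_orth uv_bound c (ltW q2).
  rewrite -[X in (X `^ _)%E]fineK; last exact: (integrable_fin_num _ il).
  rewrite -[fine _]/(lcint mu u v q c) poweR_EFin lee_fin.
  have -> : 1 - q^-1 = (q - 1) * q^-1 by field; apply: lt0r_neq0.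
  rewrite powRrM; apply: ge0_ler_powR; rewrite ?nnegrE ?powR_ge0//.
  - by rewrite invr_ge0 ltW.
  - exact: lcint_ge0.
  - apply: le_trans (hausdorff_young uv_orth uv_bound c q2) _.
    rewrite le_eqVlt; apply/orP; left; apply/eqP; congr (_ `^ _).
    apply: eq_bigr => i _; rewrite /c ger0_norm ?powR_ge0// -powRrM.
    by congr (_ `^ _); field; apply: lt0r_neq0.
have {DleJ} : (D%:E <= (D `^ (1 - q^-1))%:E * K%:E)%E.
  by apply: le_trans DleJ _; apply: lee_pmul => //; exact: Lnorm_ge0.
rewrite -EFinM lee_fin => DK.
have [->|D0'] := eqVneq D 0; first exact: powR_ge0.
have Dgt0 : 0 < D by rewrite lt_neqAle eq_sym D0'.
have {}DK : D `^ q^-1 <= K.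
  rewrite -(ler_pM2l (powR_gt0 (1 - q^-1) Dgt0)); apply: le_trans DK.
  rewrite -powRD ?D0' ?implybT// (_ : 1 - q^-1 + q^-1 = 1) ?powRr1//; ring.
have -> : D = (D `^ q^-1) `^ q.
  by rewrite -powRrM mulVf ?powRr1//; apply: lt0r_neq0.
by apply: ge0_ler_powR; rewrite ?nnegrE ?powR_ge0// ltW.
Qed.

End singular_values.

Theorem theorem3p7 (R : realType) (G : topologicalZmodType) (H : hilbertType R)
  (m : G -> G -> Cplx R) (U : G -> H -> H)
  (nu : {measure set (borel G) -> \bar R})
  (mu : {measure set (borel (dual_group R G)) -> \bar R})
  (F : (H -> H) -> borel (dual_group R G) -> Cplx R)
  (G_hausdorff : hausdorff_space G)
  (G_locally_compact : locally_compact [set: G])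
  (H_separable : separable_space (H := H))
  (U_representation : projective_representation m U)
  (U_irreducible : irreducible U)
  (m_heisenberg : heisenberg_multiplier m)
  (m_even : forall x y : G, m x y = m (- x) (- y))
  (nu_haar : haar_measure nu)
  (U_square_integrable : square_integrable U nu)
  (U_integrable : integrable_representation U nu)
  (mu_haar : haar_measure mu)
  (F_fourier : quantum_fourier m U mu F)
  (s : R) (s_gt0 : 0 < s)
  (gamma : borel (dual_group R G) -> R)
  (gamma_gt0 : forall xi, 0 < gamma xi)
  (gamma_measurable : measurable_fun [set: borel (dual_group R G)] gamma)
  (alpha : R) (s_lt_alpha : s < alpha) :
  let alpha_star := 2 * alpha / (alpha - s) in
  let w := fun xi => 1 / (1 + gamma xi ^+ 2) in
  in_Lp mu alpha w ->
  continuously_embedded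
    (sobolev mu F gamma s) (sobolev_norm mu F gamma s)
    (schatten alpha_star) (schatten_norm alpha_star) /\
  (forall T : H -> H, sobolev mu F gamma s T ->
    (schatten_norm alpha_star T <=
     sobolev_norm mu F gamma s T *
       Lnorm mu alpha%:E (EFin \o w) `^ (s / 2))%E).
Proof.
move=> q w [w_meas w_fin].
have as0 : 0 < alpha - s by lra.
have q2 : 2 < q by rewrite /q ltr_pdivlMr//; lra.
have q0 : 0 < q by lra.
set L := (Lnorm mu alpha%:E (EFin \o w) `^ (s / 2))%E.
have L0 : (0 <= L)%E by exact: poweR_ge0.
have Lfin : L \is a fin_num by rewrite ge0_fin_numE// poweR_lty.
have N0 T : (0 <= sobolev_norm mu F gamma s T)%E by exact: poweR_ge0.
have Nfin T : sobolev mu F gamma s T ->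
    sobolev_norm mu F gamma s T \is a fin_num.
  by move=> [_ h]; rewrite ge0_fin_numE// poweR_lty.
have main T : sobolev mu F gamma s T ->
    (schatten_norm q T <= sobolev_norm mu F gamma s T * L)%E.
  move=> sobT; have [sT _] := sobT.
  set K := (_ * L)%E.
  have Kfin : K \is a fin_num by rewrite fin_numM// Nfin.
  have K0 : 0 <= fine K by rewrite fine_ge0// mule_ge0.
  have FK : (Lnorm mu (q / (q - 1))%:E (fun xi => (rnorm (F T xi))%:E) <= (fine K)%:E)%E.
    have [[mr _] [mi _]] := fourier_sqint F_fourier sT.
    have -> : q / (q - 1) = 2 * alpha / (alpha + s).
      by rewrite /q; field; rewrite !gt_eqF//; lra.
    rewrite fineK//; apply: (weighted_hoelder mu (m := fun xi => rnorm (F T xi))) => //.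
    - under eq_fun do rewrite rnormE.
      exact: measurable_modulus.
    - by move=> xi; rewrite rnormE modulus_ge0.
  have : (schatten_sum q T <= ((fine K) `^ q)%:E)%E.
    apply: schatten_sum_le => [|N e r orthe r0 eigen].
      by case: sT => -[].
    exact: (singular_values_le H_separable U_representation F_fourier sT orthe).
  move=> h; rewrite schatten_normE.
  apply: (@le_trans _ _ (((fine K) `^ q)%:E `^ q^-1)%E).
    apply: gt0_ler_poweR => //; first by rewrite invr_ge0 ltW.
    - by rewrite in_itv/= schatten_sum_ge0 leey.
    - by rewrite in_itv/= lee_fin powR_ge0 leey.
  by rewrite poweR_EFin -powRrM mulfV ?gt_eqF// powRr1// fineK.
split=> //; split.
  move=> T sobT; split; first by case: sobT => -[].
  by apply: le_lt_trans (main T sobT) _; rewrite ltey_eq fin_numM// Nfin.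
(* The constant must be positive; adding 1 achieves this without a lower bound for [L]. *)
exists (fine L + 1); first by rewrite ltr_wpDl ?fine_ge0.
move=> T sobT; apply: le_trans (main T sobT) _; rewrite muleC.
apply: lee_wpmul2r => //.
by rewrite EFinD fineK// leeDl// lee_fin.
Qed.
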